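(* Let $\widehat{T}\in L(H)$ be an operator with spectrum $\sigma(\widehat{T})\subset\overline{\mathbb{D}}$, and let $\gamma$ be a function of the form $\gamma(t)=\alpha(t)\,\widetilde{\gamma}(t)$, where $\alpha\in\mathcal{A}_{\widehat{T},\mathbb{R}}$ and $\widetilde{\gamma}\in\mathcal{A}_{\widehat{T},\mathbb{R}}^0$ satisfies $\widetilde{\gamma}(t)>0$ for all $t\in[0,1]$. If $\gamma(\widehat{T}^*,\widehat{T})\ge 0$, then $\widehat{T}$ is similar to an operator $T\in L(H)$ such that $\alpha(T^*,T)\ge 0$.
   Context: $H$ is a separable Hilbert space, $L(H)$ is the algebra of bounded linear operators on $H$, and $\mathbb{D}=\{|t|<1\}$ is the open unit disc. $A_W$ is the Wiener algebra of analytic functions $\alpha(t)=\sum_{n\ge0}\alpha_n t^n$ on $\mathbb{D}$ with $\sum_n|\alpha_n|<\infty$. For $T\in L(H)$ with $\sigma(T)\subset\overline{\mathbb{D}}$: $\mathcal{A}_T$ is the set of $\alpha\in A_W$ such that $\sum_{n}|\alpha_n|T^{*n}T^n$ converges in the strong operator topology (SOT); $\mathcal{A}_T^0$ is the set of $\alpha\in A_W$ such that $\sum_n|\alpha_n|T^{*n}T^n$ converges in the operator norm of $L(H)$; $\mathcal{A}_{T,\mathbb{R}}$ and $\mathcal{A}_{T,\mathbb{R}}^0$ are the subsets of functions in $\mathcal{A}_T$ and $\mathcal{A}_T^0$, respectively, with real Taylor coefficients. For a power series $\alpha(t)=\sum_n\alpha_nt^n$, $\alpha(T^*,T):=\sum_{n=0}^\infty\alpha_nT^{*n}T^n$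 whenever this series converges in SOT (in particular it is well defined for $\alpha\in\mathcal{A}_{T,\mathbb{R}}$). Operators $T$ and $\widehat T$ are similar if $T=B\widehat TB^{-1}$ for some bounded invertible $B$. *)

(* Defs.v *)
From HB Require Import structures.
From mathcomp Require Import all_boot all_order all_algebra sesquilinear.
From mathcomp Require Import all_classical all_reals all_analysis.
From mathcomp Require Import complex.

Set Implicit Arguments.
Unset Strict Implicit.
Unset Printing Implicit Defensive.

Import Order.TTheory GRing.Theory Num.Theory Num.Def.
Import numFieldNormedType.Exports.

Local Open Scope classical_set_scope.
Local Open Scope ring_scope.

(* Scalars are taken in an arbitrary [C : numClosedFieldType] wherever the real
   numbers are not needed: it is the complex field [R[i]] in the end, but the
   topology and norm of the scalars are canonical only for an abstract [C]. *)

Section PowerSeries.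
Context {C : numClosedFieldType}.

(* An analytic function on the unit disc is represented by its sequence of
   Taylor coefficients. *)
Definition ps_has_sum (a : nat -> C) (t l : C) : Prop :=
  series (fun n => a n * t ^+ n) @ \oo --> l.

(* the value at [t], meaningful where the series converges; for a function of
   the Wiener algebra this includes the unit circle *)
Definition ps_sum (a : nat -> C) (t : C) : C :=
  limn (series (fun n => a n * t ^+ n)).

Definition wiener (a : nat -> C) : Prop := cvgn (series (fun n => `|a n|)).

Definition real_coefs (a : nat -> C) : Prop := forall n, a n \is Num.real.

End PowerSeries.

Section Operators.
Context {C : numClosedFieldType} {H : completeNormedModType C}.
Implicit Types (T S P : H -> H).

Definition bounded_op : set (H -> H) :=
  [set T | linear T /\ exists M : C, forall x, `|T x| <= M * `|x|].

Definition invertible_op T : Prop :=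
  exists2 S, bounded_op S & cancel T S /\ cancel S T.

Definition spectrum T : set C :=
  [set l | ~ invertible_op (fun x => l *: x - T x)].

Definition similar_op T S : Prop :=
  exists B B', [/\ bounded_op B, bounded_op B', cancel B B', cancel B' B &
                   T = B \o S \o B'].

Definition cvg_sot (S : nat -> H -> H) P : Prop :=
  bounded_op P /\ forall x, (fun N => S N x) @ \oo --> P x.

End Operators.

Section OperatorNorm.
Context {R : realType} {H : completeNormedModType R[i]}.

(* The norm of [H] has its values in [R[i]], hence the real part. *)
Definition op_norm (T : H -> H) : R :=
  sup [set complex.Re `|T x| | x in [set x : H | `|x| <= 1]].

Definition cvg_op_norm (S : nat -> H -> H) (P : H -> H) : Prop :=
  bounded_op P /\ (fun N => op_norm (S N \- P)) @ \oo --> (0 : R).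

End OperatorNorm.

Definition separable_space (T : topologicalType) : Prop :=
  exists2 D : set T, countable D & dense D.

Section HereditaryCalculus.
Context {C : numClosedFieldType} {H : completeNormedModType C}.
(* the inner product of [H], linear in its first argument *)
Variable ip : {dot H for @conjC C}.
Implicit Types (T : H -> H) (a : nat -> C).

(* T^*, which exists and is unique for a bounded [T] when [ip] induces the norm
   of [H] and the scalars are [R[i]] (Riesz) *)
Definition adjoint T : H -> H :=
  xget (fun=> 0) [set S | bounded_op S /\ forall x y, ip (T x) y = ip x (S y)].

(* [0 <= z] includes that [z] is real. *)
Definition nonneg_op T : Prop := forall x, 0 <= ip (T x) x.

Definition hered_psum T a (N : nat) : H -> H := fun x =>
  \sum_(0 <= n < N) a n *: iter n (adjoint T) (iter n T x).

(* alpha(T^*, T), meaningful when the series converges in SOT *)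
Definition hered_calc T a : H -> H := fun x =>
  limn (fun N => hered_psum T a N x).

Definition sot_summable T a : Prop := exists P, cvg_sot (hered_psum T a) P.

Definition calA T a : Prop := wiener a /\ sot_summable T (fun n => `|a n|).

Definition calA_R T a : Prop := calA T a /\ real_coefs a.

End HereditaryCalculus.

Section NormConvergence.
Context {R : realType} {H : completeNormedModType R[i]}.
Variable ip : {dot H for @conjC R[i]}.
Implicit Types (T : H -> H) (a : nat -> R[i]).

Definition calA0 T a : Prop :=
  wiener a /\ exists P, cvg_op_norm (hered_psum ip T (fun n => `|a n|)) P.

Definition calA0_R T a : Prop := calA0 T a /\ real_coefs a.

End NormConvergence.

(* Main.v *)
(* The form of [alpha(T^*, T)] at [x] is the series of the [alpha_n |T^n x|^2], so
   that products of power series act on forms by convolution.  Polya's theorem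
   for the positive function [gtilde] gives a power series [u] with nonnegative
   coefficients and radius of convergence larger than 1 such that the form of
   [h = u * gtilde] is bounded below; it converges because [|T^n x|] grows slower
   than any exponential.  As [alpha * h = u * gamma], replacing the inner product
   by the one given by [h(T^*, T)] makes [alpha(T^*, T)] nonnegative, and the
   square root of [h(T^*, T)] carries the new inner product to the old one. *)

Require Import Defs.
From HB Require Import structures.
From mathcomp Require Import all_boot all_order all_algebra sesquilinear.
From mathcomp Require Import all_classical all_reals all_analysis.
From mathcomp Require Import complex.
From mathcomp Require Import ring lra zify.

Import Order.TTheory GRing.Theory Num.Theory Num.Def.
Import numFieldNormedType.Exports.

Local Open Scope classical_set_scope.
Local Open Scope complex_scope.
Local Open Scope ring_scope.

Set Implicit Arguments.
Unset Strict Implicit.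
Unset Printing Implicit Defensive.

(** * Real power series *)

(** Polya's multiplier is built for polynomials, so [gtilde] has to be cut off. Convergence in
    operator norm makes the form of its tail at most [e * |x|^2] uniformly in [x], and strict
    positivity on the compact segment leaves a margin [eta] to pay for this; the margin is taken out
    of the constant coefficient. For [alpha] strong convergence is enough, since only the
    boundedness of its form enters.

    The multiplier [(1 - t)^-(L+1)] has its pole on the unit circle, whereas the spectral hypothesis
    still allows the orbits to grow subexponentially. Hence the pole is moved slightly outside of
    the closed disc, and a bound on [s^n |T^n x|] that is uniform in [x] is required for every
    [s < 1]. It comes from finite sums: on a circle of radius [s], a resolvent bound and Parseval's
    inequality bound the sum of the [s^(2n) |T^n x|^2] by a constant that does not depend on the
    decay assumed beforehand. Such a bound enlarges the admissible radius by a fixed factor, and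
    repetition reaches every radius below 1. *)

Section RealSeries.
Context {R : realType}.
Implicit Types (a b c w : nat -> R) (s : R).

Lemma series_abs_bounded a s :
    (forall N, \sum_(0 <= n < N) `|a n| <= s) ->
  cvgn (series a) /\ `|limn (series a)| <= s.
Proof.
move=> abnd.
have cva : cvgn (series a).
  apply: normed_cvg; apply: nondecreasing_is_cvgn.
    by apply: nondecreasing_series => n _ _; exact: normr_ge0.
  by exists s => _ [N _ <-]; exact: abnd.
split=> //; rewrite -lim_norm //; apply: limr_le; first exact: is_cvg_norm.
by apply: nearW => N; apply: le_trans (abnd N); exact: ler_norm_sum.
Qed.

Lemma series_tail_le c e : (forall n, 0 <= c n) -> cvgn (series c) -> 0 < e ->
  exists N, forall m d, (N <= m)%N -> \sum_(m <= n < d) c n <= e.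
Proof.
move=> c0 cvc e0; have [N _ NP] := (@cvgrPdist_le _ _ _ _ _ _ _).1 cvc _ e0.
have incr : {homo series c : n m / (n <= m)%N >-> n <= m}.
  by apply: nondecreasing_series => n _ _; exact: c0.
exists N => m d Nm; have [dm|/ltnW md] := leqP d m.
  by rewrite big_geq// ltW.
have := NP m Nm; rewrite ger0_norm ?subr_ge0; last exact: nondecreasing_cvgn_le.
have := nondecreasing_cvgn_le incr cvc d.
rewrite /series/= (@big_cat_nat _ _ _ m 0 d)//=; lra.
Qed.

(** Dominated convergence for sums whose length grows with the index: a fixed head tends to 0 term
    by term, and the rest is below a tail of [c]. *)
Lemma tannery (f : nat -> nat -> R) c :
    (forall n N, `|f n N| <= c n) -> cvgn (series c) ->
    (forall n, f n N @[N --> \oo] --> 0) ->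
  \sum_(0 <= n < N) f n N @[N --> \oo] --> 0.
Proof.
move=> fc cvc f0; apply/cvgrPdist_le => e e0.
have e20 : 0 < e / 2 by lra.
have c0 n : 0 <= c n by exact: le_trans (fc n 0%N).
have [N0 tailc] := series_tail_le c0 cvc e20.
have fin : \sum_(0 <= n < N0) f n N @[N --> \oo] --> 0.
  elim: N0 {tailc} => [|k IH].
    by under eq_fun do rewrite big_geq//; exact: cvg_cst.
  under eq_fun do rewrite big_nat_recr//=.
  by have := cvgD IH (f0 k); rewrite addr0; apply.
have [N1 _ headf] := (@cvgrPdist_le _ _ _ _ _ _ _).1 fin _ e20.
exists (maxn N0 N1) => // N; rewrite /= geq_max => /andP[NN0 NN1].
have := headf N NN1; rewrite !sub0r !normrN (@big_cat_nat _ _ _ N0 0 N)//= => h1.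
apply: le_trans (ler_normD _ _) _.
have -> : e = e / 2 + e / 2 by lra.
apply: lerD => //; apply: le_trans (tailc _ N (leqnn N0)).
by apply: le_trans (ler_norm_sum _ _ _) _; exact: ler_sum.
Qed.

Definition conv a b (n : nat) : R := \sum_(0 <= k < n.+1) a k * b (n - k)%N.

Lemma conv_triangle a b w N :
  \sum_(0 <= m < N) conv a b m * w m =
  \sum_(0 <= n < N) a n * \sum_(0 <= j < N - n) b j * w (n + j)%N.
Proof.
elim: N => [|N IH]; first by rewrite !big_geq.
rewrite big_nat_recr//= IH [RHS]big_nat_recr//= subSnn big_nat1 addn0.
rewrite /conv big_nat_recr//= subnn [in RHS]mulrA [in LHS]mulrDl addrA.
congr (_ + _); rewrite mulr_suml -big_split/= !big_nat.
apply: eq_bigr => n /andP[_ nN].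
by rewrite subSn ?(ltnW nN)// big_nat_recr//= mulrDr subnKC ?(ltnW nN)// mulrA.
Qed.

(** The weight [w] covers both uses, the powers [t ^+ n] and the squared norms along an orbit. The
    last hypothesis bounds [b] against the weight shifted by [n] in proportion to [w n]; this makes
    the double series absolutely convergent. *)
Lemma conv_series a b w A M : 0 <= M ->
    (forall n, 0 <= w n) ->
    (forall N, \sum_(0 <= n < N) `|a n| * w n <= A) ->
    (forall n N, \sum_(0 <= j < N) `|b j| * w (n + j)%N <= M * w n) ->
  [/\ forall N, \sum_(0 <= m < N) `|conv a b m| * w m <= M * A,
      cvgn (series (fun n => a n * limn (series (fun j => b j * w (n + j)%N)))) &
      series (fun m => conv a b m * w m) @ \oo -->
      limn (series (fun n => a n * limn (series (fun j => b j * w (n + j)%N))))].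
Proof.
move=> M0 w0 hA hb.
have hbn n N : \sum_(0 <= j < N) `|b j * w (n + j)%N| <= M * w n.
  by under eq_bigr do rewrite normrM (ger0_norm (w0 _)); exact: hb.
pose s n := limn (series (fun j => b j * w (n + j)%N)).
have cvs n : cvgn (series (fun j => b j * w (n + j)%N)).
  by have [] := series_abs_bounded (hbn n).
have sle n : `|s n| <= M * w n by have [] := series_abs_bounded (hbn n).
have hMA N : \sum_(0 <= n < N) `|a n| * (M * w n) <= M * A.
  by under eq_bigr do rewrite mulrCA; rewrite -mulr_sumr ler_wpM2l.
have cvas : cvgn (series (fun n => a n * s n)).
  apply: (proj1 (@series_abs_bounded (fun n => a n * s n) (M * A) _)) => N.
   apply: le_trans (hMA N); apply: ler_sum => n _.
  by rewrite normrM ler_wpM2l ?sle.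
split=> //.
- move=> N; apply: le_trans (hMA N).

  apply: (@le_trans _ _ (\sum_(0 <= m < N) conv (fun n => `|a n|) (fun n => `|b n|) m * w m)).
    apply: ler_sum => m _; rewrite ler_wpM2r// /conv.
    apply: le_trans (ler_norm_sum _ _ _) _.
    by apply: ler_sum => k _; rewrite normrM.
  rewrite conv_triangle; apply: ler_sum => n _.
  by rewrite ler_wpM2l ?hb.
(* A partial sum of the convolution is a sum over a triangle. Completing every row to its full sum
   [s n] leaves this error, which vanishes row by row and is dominated by
   [2 * (|a n| * (M * w n))]. *)
- have main : \sum_(0 <= n < N) (a n * (\sum_(0 <= j < N - n) b j * w (n + j)%N - s n))
    @[N --> \oo] --> 0.
    apply: (@tannery (fun n N => a n * (\sum_(0 <= j < N - n) b j * w (n + j)%N - s n))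
      (fun n => 2 * (`|a n| * (M * w n)))).
    + move=> n N; rewrite normrM mulrCA ler_wpM2l// mulrDl !mul1r.
      apply: le_trans (ler_normB _ _) _; apply: lerD (sle n).
      exact: le_trans (ler_norm_sum _ _ _) (hbn _ _).
    + apply: (proj1 (@series_abs_bounded (fun n => 2 * (`|a n| * (M * w n)))
        (2 * (M * A)) _)) => N.
       under eq_bigr do rewrite ger0_norm ?mulr_ge0//.
      by rewrite -mulr_sumr ler_wpM2l.
    + move=> n; have := @cvgMl_tmp _ _ \oo _
        (fun N => \sum_(0 <= j < N - n) b j * w (n + j)%N - s n) (a n) 0.
      rewrite mulr0; apply.
      have h := @cvgB _ _ _ _ _ _ _ _ _ (cvg_comp _ _ (cvg_subnr n) (cvs n)) (cvg_cst (s n)).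
      by rewrite subrr in h; exact: h.
  set l := limn _; rewrite -(add0r l).
  have -> : series (fun m => conv a b m * w m) =
    (fun N => \sum_(0 <= n < N) (a n * (\sum_(0 <= j < N - n) b j * w (n + j)%N - s n))
     + series (fun n => a n * s n) N).
    apply/funext => N; rewrite /series/= conv_triangle -big_split/=.
    by apply: eq_bigr => n _; rewrite mulrBr subrK.
  exact: cvgD.
Qed.

Lemma coef_conv a b N m : (m < N)%N ->
  (\poly_(i < N) a i * \poly_(i < N) b i)`_m = conv a b m.
Proof.
move=> mN; rewrite coefM /conv big_mkord; apply: eq_bigr => i _.
have iN : (i < N)%N by exact: leq_ltn_trans (ltnSE (ltn_ord i)) mN.
by rewrite !coef_poly iN (leq_ltn_trans (leq_subr _ _) mN).
Qed.

Lemma convC a b : conv a b = conv b a.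
Proof.
by apply/funext => m; rewrite -!(@coef_conv _ _ m.+1)// mulrC.
Qed.

(** Inherited from polynomials: the coefficient of order [m] only sees the truncations to degree at
    most [m]. *)
Lemma convA a b c : conv a (conv b c) = conv (conv a b) c.
Proof.
apply/funext => m.
have trunc (p q : {poly R}) (d : nat -> R) : (forall i, (i <= m)%N -> p`_i = d i) ->
    (p * q)`_m = (\poly_(i < m.+1) d i * q)`_m.
  move=> pd; rewrite !coefM; apply: eq_bigr => i _.
  by rewrite coef_poly ltn_ord pd// -ltnS.
rewrite -!(@coef_conv _ _ m.+1 m (ltnSn m)).
have bcE i : (i <= m)%N -> (\poly_(i < m.+1) b i * \poly_(i < m.+1) c i)`_i = conv b c i.
  by move=> im; rewrite coef_conv.
have abE i : (i <= m)%N -> (\poly_(i < m.+1) a i * \poly_(i < m.+1) b i)`_i = conv a b i.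
  by move=> im; rewrite coef_conv.
by rewrite -(trunc _ _ _ abE) mulrC -(trunc _ _ _ bcE) mulrC mulrA.
Qed.

Lemma convCA a b c : conv a (conv b c) = conv b (conv a c).
Proof. by rewrite !convA (convC a). Qed.

Lemma sum_geometric_le (q : R) : 0 <= q < 1 ->
  forall N, \sum_(0 <= j < N) q ^+ j <= (1 - q)^-1.
Proof.
move=> /andP[q0 q1] N.
rewrite -[leRHS]mul1r ler_pdivlMr ?subr_gt0//.
rewrite mulrC big_mkord -opprB mulNr -subrX1 opprB.
by rewrite gerBl exprn_ge0.
Qed.

(** Once the lower coefficients vanish, division by [t ^+ m] and a small [t] isolate [c m];
    convergence at 1/2 bounds the other coefficients by [K * 2 ^+ n]. *)
Lemma power_series_eq0 c :
    (forall t, 0 <= t < 1 -> series (fun n => c n * t ^+ n) @ \oo --> (0 : R)) ->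
  forall n, c n = 0.
Proof.
move=> cz; elim/ltn_ind => m IH.
have [K K0 cK] : exists2 K, 0 < K & forall n, `|c n| <= K * 2 ^+ n.
  have h1 : 0 <= (1/2 : R) < 1 by lra.
  have cvh : cvgn (series (fun n => c n * (1/2) ^+ n)) by apply/cvg_ex; exists 0;
    exact: cz.
  have [K [Kr bndK]] := cvg_seq_bounded (cvgP _ (cvg_series_cvg_0 cvh)).
  exists (`|K| + 1); first by rewrite ltr_pwDr.
  move=> n; have /bndK/(_ n I) : K < `|K| + 1 by rewrite ltr_pwDr// ler_norm.
  rewrite /= normrM normrX div1r normfV normr_nat exprVn.
  by rewrite ler_pdivrMr// exprn_gt0.
apply/eqP; rewrite -normr_le0; apply/ler_addgt0Pr => e e0; rewrite add0r.
have Kp : 0 < K * 2 ^+ m * 8 by rewrite !mulr_gt0// exprn_gt0.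
(* The bound 1/4 keeps the ratio [2 * t] below 1/2, so the geometric sum is at most 2; the other
   bound makes [t] times the tail bound [K * 2 ^+ m.+1 * 2] at most [e / 2]. *)
pose t := Num.min (1/4) (e / (K * 2 ^+ m * 8)).
have t0 : 0 < t by rewrite /t lt_min; apply/andP; split; [lra|rewrite divr_gt0].
have t4 : t <= 1/4 by rewrite /t ge_min lexx.
have tK : t * (K * 2 ^+ m * 8) <= e by rewrite -ler_pdivlMr// /t ge_min lexx orbT.
have tm0 : 0 < t ^+ m by rewrite exprn_gt0.
have tail N : `|\sum_(0 <= j < N) c (j + m.+1)%N * t ^+ j| <= K * 2 ^+ m.+1 * 2.
  apply: le_trans (ler_norm_sum _ _ _) _.
  apply: (@le_trans _ _ (K * 2 ^+ m.+1 * \sum_(0 <= j < N) (2 * t) ^+ j)).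
    rewrite mulr_sumr; apply: ler_sum => j _.
    rewrite normrM normrX (ger0_norm (ltW t0)) exprMn [leRHS]mulrA.
    by rewrite ler_wpM2r ?exprn_ge0 ?(ltW t0)// -mulrA -exprD addnC.
  have t2 : 0 <= 2 * t < 1 by lra.
  have geo := sum_geometric_le t2 N; rewrite ler_wpM2l ?mulr_ge0 ?exprn_ge0 ?(ltW K0)//.
  apply: le_trans geo _; rewrite -(invrK 2) lef_pV2 ?posrE; lra.
have /cz/cvgrPdist_le : 0 <= t < 1 by lra.
have eps : 0 < t ^+ m * (e / 2) by rewrite mulr_gt0// divr_gt0.
move=> /(_ _ eps) [N _ /(_ (m.+1 + N)%N (leq_addl _ _))].
rewrite /series/= sub0r normrN (@big_cat_nat _ _ _ m 0 (m.+1 + N))//= ?leq_addr//;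
  last first.
  by rewrite addSnnS leq_addr.
rewrite big_nat big1 ?add0r; last by move=> n /IH ->; rewrite mul0r.
rewrite big_ltn ?addSn ?ltnS ?leq_addr// -addSn -{1}[m.+1]add0n big_addn addKn.
under eq_bigr do rewrite exprD mulrA.
rewrite -mulr_suml exprS; have := tail N; set S := \sum_(0 <= j < N) _ => hS.
have -> : c m * t ^+ m + S * (t * t ^+ m) = t ^+ m * (c m + t * S) by ring.
rewrite normrM gtr0_norm// ler_pM2l// => cmS.
have {}hS : `|t * S| <= e / 2.
  rewrite normrM gtr0_norm//; apply: le_trans (ler_wpM2l (ltW t0) hS) _.
  rewrite exprS; lra.
have := ler_normB (c m + t * S) (t * S); rewrite addrK; lra.
Qed.
End RealSeries.

(** * Polya's theorem *)

Section Polya.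
Context {R : realType}.
Implicit Types (p u : nat -> R).

(** Quotient of the coefficients of order [n - m] and [n] of [(1 - t)^-(L+1)]. It is the product
    over [i < m] of the [(n - i) / (n - i + L)], which explains the value 0 for [m > n]. *)
Definition bin_ratio (L n m : nat) : R :=
  if (m <= n)%N then 'C(n - m + L, L)%:R / 'C(n + L, L)%:R else 0.

Lemma bin_ratioS L n m : (0 < L)%N ->
  bin_ratio L n m.+1 = bin_ratio L n m * ((n - m)%:R / (n - m + L)%:R).
Proof.
move=> L0; rewrite /bin_ratio; have [mn|nm|->] := ltngtP m n.
- have -> : (n - m = (n - m.+1).+1)%N by rewrite subnSK.
  set k := (n - m.+1)%N.
  have := mul_bin_down (k.+1 + L) L; rewrite addnK addSn/= => e.
  have k0 : (k + L).+1%:R != 0 :> R by rewrite pnatr_eq0.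
  have : (k + L).+1%:R * 'C(k + L, L)%:R = k.+1%:R * 'C((k + L).+1, L)%:R :> R.
    by rewrite -!natrM e.
  move=> /(canRL (mulKf k0)) ->.
  by rewrite [_ / _ * _]mulrAC; congr (_ / _); rewrite mulrC [in RHS]mulrC mulrAC.
- by rewrite mul0r.
- by rewrite subnn mul0r mulr0.
Qed.

Lemma bin_ratio_le1 L n m : (0 < L)%N -> 0 <= bin_ratio L n m <= 1.
Proof.
move=> L0; elim: m => [|m /andP[r0 r1]].
  by rewrite /bin_ratio leq0n subn0 divff ?lexx ?ler01// pnatr_eq0 -lt0n bin_gt0 leq_addl.
rewrite bin_ratioS//.
have q0 : 0 <= (n - m)%:R / (n - m + L)%:R :> R by rewrite divr_ge0.
have q1 : (n - m)%:R / (n - m + L)%:R <= 1 :> R.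
  by rewrite ler_pdivrMr ?mul1r ?ler_nat ?leq_addr// ltr0n addn_gt0 L0 orbT.
by rewrite mulr_ge0//= mulr_ile1.
Qed.

(** For [i <= n] the factor [(n - i) / (n - i + L)] differs from [n / (n + L)] by
    [i L / ((n + L)(n - i + L)) <= i / L]. The error is uniform in [n], so one [L] serves all
    coefficients. *)
Lemma bin_ratio_approx L n m : (0 < L)%N ->
  `|bin_ratio L n m - (n%:R / (n + L)%:R) ^+ m| <= (m * m)%:R / L%:R.
Proof.
move=> L0; set x := n%:R / (n + L)%:R.
have x0 : 0 <= x by rewrite divr_ge0.
have Lp : 0 < L%:R :> R by rewrite ltr0n.
have nLp k : 0 < (k + L)%:R :> R by rewrite ltr0n addn_gt0 L0 orbT.
have x1 : x <= 1 by rewrite ler_pdivrMr ?mul1r ?ler_nat ?leq_addr.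
elim: m => [|m IH].
  by rewrite /bin_ratio leq0n subn0 divff ?subrr ?normr0 ?mulr0n ?mul0r//
    pnatr_eq0 -lt0n bin_gt0 leq_addl.
rewrite bin_ratioS// exprSr; set q := _ / _%:R.
have /andP[r0 r1] := bin_ratio_le1 n m L0.
have step : bin_ratio L n m * `|q - x| <= m%:R / L%:R.
  have [mn|nm] := leqP m n; last first.
    by rewrite /bin_ratio leqNgt nm mul0r divr_ge0.
  rewrite -[leRHS]mul1r; apply: ler_pM => //.
  have -> : q - x = - (m%:R * L%:R / ((n + L)%:R * (n - m + L)%:R)).
    rewrite /q /x; have := nLp (n - m)%N; have := nLp n.
    rewrite !natrD natrB// => h1 h2; field.
    by rewrite !gt_eqF.
  rewrite normrN ger0_norm; last by rewrite divr_ge0// mulr_ge0.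
  rewrite ler_pdivrMr ?mulr_gt0// -mulrA ler_wpM2l// mulrC ler_pdivlMr//.
  by apply: ler_pM; rewrite ?ler_nat// ?leq_addl.
have -> : bin_ratio L n m * q - x ^+ m * x =
  (bin_ratio L n m - x ^+ m) * x + bin_ratio L n m * (q - x) by ring.
apply: le_trans (ler_normD _ _) _;
  rewrite (normrM _ x) (normrM _ (q - x)) (ger0_norm x0) (ger0_norm r0).
have : `|bin_ratio L n m - x ^+ m| * x <= (m * m)%:R / L%:R.
  by rewrite -[leRHS]mulr1; apply: ler_pM.
have -> : (m.+1 * m.+1)%:R / L%:R = (m * m)%:R / L%:R + m%:R / L%:R + m.+1%:R / L%:R :> R.
  by rewrite -!mulrDl -!natrD; congr (_%:R / _); lia.
have : 0 <= m.+1%:R / L%:R :> R by rewrite divr_ge0.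
move: step; lra.
Qed.

(** Convexity: on [[0, 1]] the power lies below its chord. *)
Lemma exprD1_le (h : R) k : 0 <= h <= 1 -> (1 + h) ^+ k - 1 <= h * (2 ^+ k - 1).
Proof.
move=> /andP[h0 h1]; elim: k => [|k IH]; first by rewrite !expr0; lra.
rewrite !exprS; set A := (1 + h) ^+ k in IH *; set B := 2 ^+ k in IH *.
have B1 : 1 <= B by rewrite exprn_ege1// ler1n.
have : h * A <= h * B.
  by apply: ler_wpM2l => //; apply: le_trans (_ : A <= 1 + h * (B - 1)) _; nra.
lra.
Qed.

(** One term of the binomial expansion of [(s + (1 - s)) ^+ (n + L) = 1]. *)
Lemma bin_geometric_le (s : R) L n : 0 < s < 1 ->
  'C(n + L, L)%:R * s ^+ n <= (1 - s) ^- L.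
Proof.
move=> /andP[s0 s1]; have s1' : 0 < 1 - s by rewrite subr_gt0.
rewrite -[leRHS]mul1r ler_pdivlMr ?exprn_gt0//.
have := exprDn s (1 - s) (n + L); rewrite addrCA subrr addr0 expr1n => e.
have Ln : (L < (n + L).+1)%N by rewrite ltnS leq_addl.
rewrite [leRHS]e (bigD1 (Ordinal Ln))//= addnK -[X in _ <= X + _]mulr_natl mulrA lerDl.
by apply: sumr_ge0 => i _; rewrite mulrn_wge0// mulr_ge0// exprn_ge0// ltW.
Qed.

(* On the coefficients of [p], multiplication by [(1 - s^3 t)^-(L+1)] tends to
   sampling of [p] on [[0, s^-3]] as [L] grows; this is Polya's argument, with a
   pole outside of the closed disc. *)
Lemma polya p d eta : 0 < eta -> (forall n, (d <= n)%N -> p n = 0) ->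
    (forall x, 0 <= x <= 1 -> eta <= \sum_(0 <= m < d) p m * x ^+ m) ->
  exists s u K, [/\ 0 < s < 1, u 0%N = 1,
    forall n, 0 <= u n <= K * s ^+ (2 * n) & forall n, 0 <= conv u p n].
Proof.
move=> eta0 pd ppos.
pose P := \sum_(0 <= m < d) `|p m| + 1.
have P1 : 1 <= P by rewrite lerDr; apply: sumr_ge0.
have P0 : 0 < P by exact: lt_le_trans P1.
(* [8 ^+ d = 2 ^+ (3 * d)] dominates the factors that [exprD1_le] gives for the exponents [3 * m]
   with [m < d]. Then [h] and [L] are chosen to make each of [P * (h * E)] and [P * (d * d) / L] at
   most [eta / 4]. *)
pose E := 8 ^+ d : R; have E0 : 0 < E by rewrite exprn_gt0.
pose h := Num.min 1 (eta / (4 * P * E)).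
have PE0 : 0 < 4 * P * E by rewrite !mulr_gt0.
have h0 : 0 < h by rewrite lt_min ltr01 divr_gt0.
have h1 : h <= 1 by rewrite ge_min lexx.
have hP : h * (4 * P * E) <= eta by rewrite -ler_pdivlMr// ge_min lexx orbT.
have [L0 /ltW hL0] : exists L : nat, 4 * P * (d * d)%:R / eta < L%:R.
  by eexists; exact: truncnS_gt.
pose L := L0.+1.
have hL : P * ((d * d)%:R / L%:R) <= eta / 4.
  have Lp : 0 < L%:R :> R by rewrite ltr0n.
  have LL0 : L0%:R <= L%:R :> R by rewrite ler_nat.
  rewrite mulrA ler_pdivrMr//; move: hL0; rewrite ler_pdivrMr//; nra.
pose s := (1 + h)^-1; pose S := (1 + h) ^+ 3.
have hp : 0 < 1 + h by lra.
have s01 : 0 < s < 1 by rewrite invr_gt0 hp invf_lt1//; lra.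
pose u n := 'C(n + L, L)%:R * s ^+ (3 * n).
have s0 : 0 < s by case/andP: s01.
have u0 n : 0 <= u n by rewrite mulr_ge0// exprn_ge0// ltW.
exists s, u, ((1 - s) ^- L); split=> //.
- by rewrite /u add0n binn muln0 expr0 mulr1.
(* One of the three factors [s ^+ n] absorbs the binomial coefficient. The other two remain, in the
   exponent that matches squared norms in [orbit_decay]. *)
- move=> n; rewrite u0/= /u (_ : 3 * n = n + 2 * n)%N; last by lia.
  by rewrite exprD mulrA ler_wpM2r ?bin_geometric_le// exprn_ge0// ltW.
move=> n.
(* The quotient [u (n - m) / u n] is [S ^+ m * bin_ratio L n m]. It vanishes for [m > n] and [p m]
   vanishes for [m >= d], so both ranges of summation extend to a common one. *)
have -> : conv u p n = u n * \sum_(0 <= m < d) p m * (S ^+ m * bin_ratio L n m).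
  rewrite convC /conv mulr_sumr.
  pose g m := u n * (p m * (S ^+ m * bin_ratio L n m)).
  have gE m : (m < n.+1)%N -> p m * u (n - m)%N = g m.
    rewrite ltnS => mn; rewrite /g [RHS]mulrCA; congr (_ * _); rewrite /u /bin_ratio mn.
    have C0 : 'C(n + L, L)%:R != 0 :> R by rewrite pnatr_eq0 -lt0n bin_gt0 leq_addl.
    have -> : s ^+ (3 * n) = s ^+ (3 * (n - m)) * S ^- m.
      by rewrite /S -exprM -exprVn -exprD -mulnDr subnK.
    have S0 : S ^+ m != 0 by rewrite expf_neq0// expf_neq0// gt_eqF.
    by field; rewrite C0 S0.
  have gd m : (d <= m)%N -> g m = 0 by move=> /pd pm; rewrite /g pm mul0r mulr0.
  have gn m : (n.+1 <= m)%N -> g m = 0.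
    by move=> nm; rewrite /g /bin_ratio leqNgt nm !mulr0.
  rewrite big_nat (eq_bigr g); last by move=> m /andP[_ /gE].
  rewrite -big_nat.
  transitivity (\sum_(0 <= m < n.+1 + d) g m).
    rewrite (@big_cat_nat _ _ _ n.+1 0 (n.+1 + d))//= ?leq_addr//.
    by rewrite [X in _ + X]big_nat [X in _ + X]big1 ?addr0// => m /andP[/gn].
  rewrite (@big_cat_nat _ _ _ d 0 (n.+1 + d))//= ?leq_addl//.
  by rewrite [X in _ + X]big_nat [X in _ + X]big1 ?addr0// => m /andP[/gd].
apply: mulr_ge0 => //.
(* The sampling point: [S ^+ m] is close to 1 and [bin_ratio L n m] to [x ^+ m], so the sum is
   within [eta / 2] of the value of [p] at [x]. *)
pose x : R := n%:R / (n + L)%:R.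
have x01 : 0 <= x <= 1.
  by rewrite divr_ge0//= ler_pdivrMr ?mul1r ?ler_nat ?leq_addr// ltr0n addn_gt0 orbT.
have err m : (m < d)%N -> `|S ^+ m * bin_ratio L n m - x ^+ m| <= h * E + (d * d)%:R / L%:R.
  move=> md; have /andP[r0 r1] := bin_ratio_le1 n m (isT : 0 < L)%N.
  have -> : S ^+ m * bin_ratio L n m - x ^+ m =
    (S ^+ m - 1) * bin_ratio L n m + (bin_ratio L n m - x ^+ m) by ring.
  apply: le_trans (ler_normD _ _) _; apply: lerD.
    have hh : 0 <= h <= 1 by rewrite ltW.
    have S1 : 0 <= S ^+ m - 1 by rewrite subr_ge0 !exprn_ege1// lerDl ltW.
    rewrite normrM (ger0_norm S1) (ger0_norm r0) -[leRHS]mulr1.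
    apply: ler_pM => //; rewrite /S -exprM.
    apply: le_trans (exprD1_le _ hh) _; rewrite ler_wpM2l ?(ltW h0)//.
    apply: (@le_trans _ _ (2 ^+ (3 * m))); first by rewrite gerBl.
    have -> : E = 2 ^+ (3 * d).
      by rewrite exprM; congr (_ ^+ _); ring.
    by rewrite ler_eXn2l ?ltr1n// leq_mul2l ltnW// orbT.
  apply: le_trans (bin_ratio_approx _ _ _) _ => //.
  by rewrite ler_wpM2r ?invr_ge0// ler_nat leq_mul// ltnW.
have : `|\sum_(0 <= m < d) p m * (S ^+ m * bin_ratio L n m) - \sum_(0 <= m < d) p m * x ^+ m|
    <= eta / 2.
  rewrite -sumrB; apply: le_trans (ler_norm_sum _ _ _) _.
  apply: (@le_trans _ _ (\sum_(0 <= m < d) `|p m| * (h * E + (d * d)%:R / L%:R))).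
    rewrite !big_nat; apply: ler_sum => m /andP[_ md].
    by rewrite -mulrBr normrM ler_wpM2l// err.
  have e0 : 0 <= h * E + (d * d)%:R / L%:R.
    by rewrite addr_ge0 ?divr_ge0 ?mulr_ge0 ?(ltW h0) ?(ltW E0).
  rewrite -mulr_suml; apply: (@le_trans _ _ (P * (h * E + (d * d)%:R / L%:R))).
    by rewrite ler_wpM2r// lerDl.
  rewrite mulrDr; have : P * (h * E) = h * (4 * P * E) / 4 by field.
  move=> ->; lra.
have := ppos _ x01; rewrite ler_norml; set A := \sum_(_ <= _ < _) _;
  set B := \sum_(_ <= _ < _) _.
by move=> hA /andP[hB _]; move: hA hB eta0; rewrite -/B; lra.
Qed.

End Polya.

(** Compactness of [[0, 1]] makes the local bounds uniform. A single index [n] is both the threshold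
    for truncation and, through [1 / (n + 1)], the lower bound, so that the local statement weakens
    as [n] grows. *)
Lemma wiener_positive_truncation (R : realType) (g : nat -> R) :
    cvgn (series (fun n => `|g n|)) ->
    (forall t : R, 0 <= t <= 1 ->
      exists2 l : R, 0 < l & series (fun n => g n * t ^+ n) @ \oo --> l) ->
  exists2 eta, 0 < eta & exists N, forall d x, (N <= d)%N -> 0 <= x <= 1 ->
    eta <= \sum_(0 <= m < d) g m * x ^+ m.
Proof.
move=> cvg gpos.
pose P (n : nat) (x : R) := 0 <= x <= 1 -> forall d, (n <= d)%N ->
  n.+1%:R^-1 <= \sum_(0 <= m < d) g m * x ^+ m.
have /compact_near_coveringP/(_ nat \oo P _) : compact `[0 : R, 1] by exact: segment_compact.
case=> [t|N _ NP]; last first.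
  exists N.+1%:R^-1; first by rewrite invr_gt0.
  by exists N => d x Nd x01; apply: (NP N (leqnn N)) => //=; rewrite in_itv.
rewrite /= in_itv/= => t01; have [l l0 cvl] := gpos _ t01.
(* The partial sum at [t], the continuity of the polynomial and the tail at [x] each cost at most
   [l / 8]; what is left of [l] exceeds [1 / (n + 1) < l / 8]. *)
have l8 : 0 < l / 8 by rewrite divr_gt0.
have [N1 _ N1P] := (@cvgrPdist_le _ _ _ _ _ _ _).1 cvl _ l8.
have [N2 N2P] := series_tail_le (fun n => normr_ge0 (g n)) cvg l8.
pose N := maxn N1 N2; pose p := \poly_(m < N) g m.
have pE x : p.[x] = \sum_(0 <= m < N) g m * x ^+ m.
  by rewrite horner_poly big_mkord.
have [N3 _ N3P] := near_infty_natSinv_lt (PosNum l8).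
have /cvgrPdist_le/(_ _ l8) ptx : p.[x] @[x --> t] --> p.[t].
  exact: continuous_horner.
exists ([set x | `|p.[t] - p.[x]| <= l / 8], [set n | (maxn N N3 <= n)%N]).
  by split => //=; exists (maxn N N3).
case=> x n [/=]; rewrite geq_max => ptpx /andP[Nn N3n] x01 d nd.
have := N1P N (leq_maxl _ _); rewrite /series/= -pE => h1.
rewrite (@big_cat_nat _ _ _ N 0 d)//= -?pE ?(leq_trans Nn)//.
have : `|\sum_(N <= m < d) g m * x ^+ m| <= l / 8.
  apply: le_trans (N2P N d (leq_maxr _ _)); apply: le_trans (ler_norm_sum _ _ _) _.
  apply: ler_sum => m _; rewrite normrM ler_piMr// normrX.
  by case/andP: x01 => x0 x1; rewrite ger0_norm// exprn_ile1.
move: (\sum_(N <= m < d) _) => s1; rewrite ler_norml => /andP[s1l _].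
have i1 : n.+1%:R^-1 < l / 8 by exact: (N3P n N3n).
apply: le_trans (ltW i1) _; move: ptpx h1; rewrite !ler_norml.
move: (p.[t] : R) (p.[x] : R) => q1 q2 /andP[_ ?] /andP[_ ?].
lra.
Qed.

(* [R[i]] as an abstract field, for which the topology is canonical. *)
Definition complex_field (R : realType) : numClosedFieldType := R[i].

(** * Passage between complex and real series, and the coefficients of a product *)

Section ComplexSeries.
Context {R : realType}.
Local Notation C := (complex_field R).
Implicit Types (u a b c : nat -> R).

Lemma cvg_Re (u : nat -> C) (l : C) :
  u @ \oo --> l -> complex.Re (u n) @[n --> \oo] --> complex.Re l.
Proof.
move=> ul; apply/cvgrPdist_le => e e0.
have e1 : 0 < (e%:C : C) by rewrite ltcR.
have [N _ hN] := (@cvgrPdist_le _ _ _ _ _ _ _).1 ul _ e1; exists N => // n /hN h.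
rewrite -lecR -raddfB; exact: (le_trans (normc_ge_Re (l - u n)) h).
Qed.

Lemma cvg_Im (u : nat -> C) (l : C) :
  u @ \oo --> l -> complex.Im (u n) @[n --> \oo] --> complex.Im l.
Proof.
move=> ul; have ImE (z : C) : complex.Im z = complex.Re (- 'i%C * z).
  by case: z => a b /=; rewrite oppr0 mul0r mulN1r opprK add0r.
rewrite ImE; under eq_fun do rewrite ImE.
by apply: cvg_Re; exact: cvgMl_tmp.
Qed.

Lemma cvg_real_complex u (l : R) : u @ \oo --> l -> ((u n)%:C : C) @[n --> \oo] --> (l%:C : C).
Proof.
move=> ul; apply/cvgrPdist_le => e e0.
have er : e = (complex.Re e)%:C by rewrite RRe_real// gtr0_real.
have e1 : 0 < complex.Re e by rewrite -ltcR -er.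
have [N _ hN] := (@cvgrPdist_le _ _ _ _ _ _ _).1 ul _ e1; exists N => // n /hN.
by rewrite er -rmorphB normc_def/= expr0n addr0 sqrtr_sqr lecR.
Qed.

Lemma wiener_real a : wiener (fun n => (a n)%:C : C) -> cvgn (series (fun n => `|a n|)).
Proof.
move=> cva; have /cvg_Re := cva; set l := complex.Re _.
have -> : (fun N => complex.Re (series (fun n => `|(a n)%:C|) N)) = series (fun n => `|a n|).
  apply/funext => N; rewrite /series/= raddf_sum; apply: eq_bigr => n _.
  by rewrite normc_def/= expr0n addr0 sqrtr_sqr.
by move=> h; apply: cvgP h.
Qed.

Lemma wiener_series_cvg a (t : R) : cvgn (series (fun n => `|a n|)) -> 0 <= t <= 1 ->
  (forall N, \sum_(0 <= n < N) `|a n| * t ^+ n <= limn (series (fun n => `|a n|))) /\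
  cvgn (series (fun n => a n * t ^+ n)).
Proof.
move=> cva /andP[t0 t1].
have bnd N : \sum_(0 <= n < N) `|a n| * t ^+ n <= limn (series (fun n => `|a n|)).
  apply: (@le_trans _ _ (series (fun n => `|a n|) N)).
    by apply: ler_sum => n _; rewrite ler_piMr// exprn_ile1.
  by apply: nondecreasing_cvgn_le => //; apply: nondecreasing_series.
split=> //; apply: (proj1 (@series_abs_bounded _ (fun n => a n * t ^+ n) _ _)) => N.
by under eq_bigr do rewrite normrM (ger0_norm (exprn_ge0 _ t0)); exact: bnd.
Qed.

Lemma series_real_complex a (t : R) :
  series (fun n => (a n)%:C * (t%:C : C) ^+ n) = (fun N => (series (fun n => a n * t ^+ n) N)%:C).
Proof.
apply/funext => N; rewrite /series/= rmorph_sum; apply: eq_bigr => n _.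
by rewrite rmorphM rmorphXn.
Qed.

Lemma ps_sum_real a (t : R) : cvgn (series (fun n => a n * t ^+ n)) ->
  ps_sum (fun n => (a n)%:C : C) (t%:C : C) = (limn (series (fun n => a n * t ^+ n)))%:C.
Proof.
move=> cva; apply/cvg_lim => //; rewrite series_real_complex.
exact: cvg_real_complex.
Qed.

Lemma cauchy_product a b (t : R) :
    cvgn (series (fun n => `|a n|)) -> cvgn (series (fun n => `|b n|)) -> 0 <= t <= 1 ->
  series (fun n => conv a b n * t ^+ n) @ \oo -->
  limn (series (fun n => a n * t ^+ n)) * limn (series (fun n => b n * t ^+ n)).
Proof.
move=> cva cvb t01; have /andP[t0 t1] := t01.
have [bnda cvat] := wiener_series_cvg cva t01.
have [bndb cvbt] := wiener_series_cvg cvb t01.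
have tn0 n : 0 <= t ^+ n by rewrite exprn_ge0.
have B0 : 0 <= limn (series (fun n => `|b n|)) by have := bndb 0%N; rewrite big_geq.
have [] := @conv_series _ a b (fun n => t ^+ n) _ _ B0 tn0 bnda.
  move=> n N; under eq_bigr do rewrite exprD mulrCA.
  by rewrite -mulr_sumr mulrC ler_wpM2r.
move=> _ _; set s := limn _; set g := limn (series (fun n => b n * t ^+ n)).
suff -> : s = limn (series (fun n => a n * t ^+ n)) * g by [].
rewrite /s; apply/cvg_lim => //.
have -> : series (fun n => a n * limn (series (fun j => b j * t ^+ (n + j)))) =
    (fun N => series (fun n => a n * t ^+ n) N * g).
  apply/funext => N; rewrite /series/= mulr_suml; apply: eq_bigr => n _.
  have h : series (fun j => b j * t ^+ (n + j)) @ \oo --> t ^+ n * g.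
    have -> : series (fun j => b j * t ^+ (n + j)) =
        (fun K => t ^+ n * series (fun j => b j * t ^+ j) K).
      apply/funext => K; rewrite /series/= mulr_sumr; apply: eq_bigr => j _.
      by rewrite exprD mulrCA.
    by apply: cvgMl_tmp.
  by rewrite -mulrA; congr (_ * _); exact: cvg_lim h.
by apply: cvgMr_tmp.
Qed.

(** [gamma] is known only through its sums in the disc. On the real segment [[0, 1)] the imaginary
    parts sum to 0 and the real parts to the Cauchy product; uniqueness of coefficients
    concludes. *)
Lemma product_coefs a b (gamma : nat -> C) :
    cvgn (series (fun n => `|a n|)) -> cvgn (series (fun n => `|b n|)) ->
    (forall t : C, `|t| < 1 -> ps_has_sum gamma t
      (ps_sum (fun n => (a n)%:C : C) t * ps_sum (fun n => (b n)%:C : C) t)) ->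
  gamma = (fun n => (conv a b n)%:C).
Proof.
move=> cva cvb hg.
have main (t : R) : 0 <= t < 1 ->
    series (fun n => complex.Re (gamma n) * t ^+ n) @ \oo -->
      limn (series (fun n => a n * t ^+ n)) * limn (series (fun n => b n * t ^+ n)) /\
    series (fun n => complex.Im (gamma n) * t ^+ n) @ \oo --> (0 : R).
  move=> /andP[t0 t1]; have t01 : 0 <= t <= 1 by rewrite t0 ltW.
  have tC1 : `|(t%:C : C)| < 1 :> R[i].
    by rewrite normc_def/= expr0n addr0 sqrtr_sqr ger0_norm// ltcR.
  have [_ cvat] := wiener_series_cvg cva t01.
  have [_ cvbt] := wiener_series_cvg cvb t01.
  have := hg _ tC1; rewrite /ps_has_sum !ps_sum_real// -rmorphM => hgt.
  have ReE N : complex.Re (series (fun n => gamma n * (t%:C : C) ^+ n) N) =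
      series (fun n => complex.Re (gamma n) * t ^+ n) N.
    rewrite /series/= raddf_sum; apply: eq_bigr => n _.
    by rewrite -rmorphXn; case: (gamma n) => p q /=; rewrite mulr0 subr0.
  have ImE N : complex.Im (series (fun n => gamma n * (t%:C : C) ^+ n) N) =
      series (fun n => complex.Im (gamma n) * t ^+ n) N.
    rewrite /series/= raddf_sum; apply: eq_bigr => n _.
    by rewrite -rmorphXn; case: (gamma n) => p q /=; rewrite mulr0 add0r mulrC.
  split.
    by have := cvg_Re hgt; under eq_fun do rewrite ReE.
  by have := cvg_Im hgt; under eq_fun do rewrite ImE.
have Im0 := power_series_eq0 (fun t t01 => (main t t01).2).
have Re0 : forall n, complex.Re (gamma n) - conv a b n = 0.
  apply: power_series_eq0 => t t01; have [h _] := main t t01.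
  have /andP[t0 t1] := t01; have t01' : 0 <= t <= 1 by rewrite t0 ltW.
  have h2 := cvgB h (cauchy_product cva cvb t01'); rewrite subrr in h2.
  have -> : series (fun n => (complex.Re (gamma n) - conv a b n) * t ^+ n) =
      series (fun n => complex.Re (gamma n) * t ^+ n) -
      series (fun n => conv a b n * t ^+ n).
    apply/funext => N; rewrite fctE /series/= -sumrB.
    by apply: eq_bigr => n _; rewrite mulrBl.
  exact: h2.
apply/funext => n; have := Re0 n; have := Im0 n; case: (gamma n) => p q /= -> /eqP.
by rewrite subr_eq0 => /eqP ->.
Qed.

End ComplexSeries.

(** * Operators on the Hilbert space *)

Section RealInnerProduct.
Context {R : realType} {H : completeNormedModType R[i]}.
Variable ip : {dot H for @conjC R[i]}.
Hypothesis norm_ip : forall x : H, `|x| ^+ 2 = ip x x.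
Implicit Types (x y : H) (r : R) (T S : H -> H).

(* The norm and the inner product of [H] have their values in [R[i]]; [nr], [rip]
   and [sq] are their real counterparts. *)
Definition nr x : R := complex.Re `|x|.
Definition rip x y : R := complex.Re (ip x y).
Definition sq x : R := rip x x.

Lemma norm_nr x : `|x| = (nr x)%:C.
Proof. by rewrite /nr RRe_real// ger0_real. Qed.

Lemma nr_ge0 x : 0 <= nr x.
Proof. by rewrite -ler0c -norm_nr normr_ge0. Qed.

Lemma ip_sq x : ip x x = (sq x)%:C.
Proof. by rewrite /sq /rip -norm_ip norm_nr -rmorphXn. Qed.

Lemma sq_nr x : sq x = nr x ^+ 2.
Proof. by rewrite /sq /rip -norm_ip norm_nr -rmorphXn. Qed.

Lemma sq_ge0 x : 0 <= sq x.
Proof. by rewrite sq_nr sqr_ge0. Qed.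

Lemma nr_eq0 x : nr x = 0 -> x = 0.
Proof. by move=> e; apply/normr0_eq0; rewrite norm_nr e. Qed.

Lemma nrD x y : nr (x + y) <= nr x + nr y.
Proof. by rewrite -lecR rmorphD/= -!norm_nr ler_normD. Qed.

Lemma nrN x : nr (- x) = nr x.
Proof. by rewrite /nr normrN. Qed.

Lemma nrB x y : nr (x - y) <= nr x + nr y.
Proof. by rewrite -(nrN y) nrD. Qed.

Lemma nr_distC x y : nr (x - y) = nr (y - x).
Proof. by rewrite -nrN opprB. Qed.

Lemma nr0 : nr (0 : H) = 0.
Proof. by rewrite /nr normr0. Qed.

Lemma nrZ (z : R[i]) x : nr (z *: x) = complex.Re `|z| * nr x.
Proof.
rewrite /nr normrZ [in LHS]norm_nr -(RRe_real (normr_real z)).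
by rewrite -rmorphM.
Qed.

Lemma nrZr r x : nr (r%:C *: x) = `|r| * nr x.
Proof. by rewrite nrZ normc_def/= expr0n addr0 sqrtr_sqr. Qed.

Lemma ripDl x y z : rip (x + y) z = rip x z + rip y z.
Proof. by rewrite /rip linearDl raddfD. Qed.

Lemma ripDr x y z : rip x (y + z) = rip x y + rip x z.
Proof. by rewrite /rip linearDr raddfD. Qed.

Lemma ripZl r x y : rip (r%:C *: x) y = r * rip x y.
Proof. by rewrite /rip linearZl_LR/=; case: (ip x y) => a b /=;
  rewrite mul0r subr0. Qed.

Lemma Re_conj (z : R[i]) : complex.Re (z^*)%R = complex.Re z.
Proof. by case: z. Qed.

Lemma ripC x y : rip x y = rip y x.
Proof. by rewrite /rip hermC expr0 mul1r Re_conj. Qed.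

Lemma ripZr r x y : rip x (r%:C *: y) = r * rip x y.
Proof. by rewrite ripC ripZl ripC. Qed.

Lemma rip0l y : rip 0 y = 0.
Proof. by rewrite /rip linear0l. Qed.

Lemma ripNl x y : rip (- x) y = - rip x y.
Proof. by rewrite /rip linearNl raddfN. Qed.

Lemma ripNr x y : rip x (- y) = - rip x y.
Proof. by rewrite ripC ripNl ripC. Qed.

Lemma rip_suml (I : Type) (s : seq I) (F : I -> H) y :
  rip (\sum_(i <- s) F i) y = \sum_(i <- s) rip (F i) y.
Proof. by rewrite /rip linear_sumlz raddf_sum. Qed.

Lemma sqD x y : sq (x + y) = sq x + 2 * rip x y + sq y.
Proof. rewrite /sq !ripDl !ripDr (ripC y x); ring. Qed.

Lemma sqN x : sq (- x) = sq x.
Proof. by rewrite /sq ripNl ripNr opprK. Qed.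

Lemma sqB x y : sq (x - y) = sq x - 2 * rip x y + sq y.
Proof. rewrite sqD sqN ripNr; ring. Qed.

Lemma sqZ (z : R[i]) x : sq (z *: x) = complex.Re `|z| ^+ 2 * sq x.
Proof. by rewrite !sq_nr nrZ exprMn. Qed.

Lemma parallelogram x y : sq (x + y) + sq (x - y) = 2 * (sq x + sq y).
Proof. rewrite sqD sqB; ring. Qed.

Lemma rip_weighted_le r x y : 0 < r -> 2 * rip x y <= r * sq x + r^-1 * sq y.
Proof.
move=> r0; have := sq_ge0 (r%:C *: x - y).
rewrite sqB ripZl /sq ripZl ripZr -/(sq x) -/(sq y) => h.
rewrite -(ler_pM2l r0) mulrDr mulrA (mulrA r r^-1) divff ?gt_eqF// mul1r; lra.
Qed.

Lemma rip_le_nr x y : `|rip x y| <= nr x * nr y.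
Proof.
wlog h : x / 0 <= rip x y.
  move=> hw.
  have [r0|r0] := leP 0 (rip x y); first exact: hw.
  by rewrite -normrN -ripNl -(nrN x) hw// ripNl oppr_ge0 ltW.
have [nx0 ny0] := (nr_ge0 x, nr_ge0 y).
rewrite ger0_norm//; apply/ler_addgt0Pr => e e0.
have [nx|nx] := leP (nr x) 0.
  have /nr_eq0 -> : nr x = 0 by apply/eqP; rewrite eq_le nx nx0.
  by rewrite rip0l nr0 mul0r add0r ltW.
have [ny|ny] := leP (nr y) 0.
  have /nr_eq0 -> : nr y = 0 by apply/eqP; rewrite eq_le ny ny0.
  by rewrite ripC rip0l nr0 mulr0 add0r ltW.
(* With this weight both terms of [rip_weighted_le] equal [nr x * nr y]. *)
have q0 : 0 < nr y / nr x by rewrite divr_gt0.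
have := rip_weighted_le x y q0; rewrite !sq_nr invf_div.
have -> : nr y / nr x * nr x ^+ 2 = nr x * nr y by field; rewrite gt_eqF.
have -> : nr x / nr y * nr y ^+ 2 = nr x * nr y by field; rewrite gt_eqF.
lra.
Qed.

Lemma cvg_nrP (u : nat -> H) (l : H) : u @ \oo --> l <->
  forall e : R, 0 < e -> \forall n \near \oo, nr (l - u n) <= e.
Proof.
split=> [/cvgrPdist_le h e e0|h].
  have /h : 0 < e%:C by rewrite ltcR.
  by apply: filterS => n; rewrite norm_nr lecR.
apply/cvgrPdist_le => e e0.
have er : e = (complex.Re e)%:C by rewrite RRe_real// gtr0_real.
have /h : 0 < complex.Re e by rewrite -ltcR -er.
by apply: filterS => n; rewrite er norm_nr lecR.
Qed.

Lemma cvg_nr (u : nat -> H) (l : H) : u @ \oo --> l -> nr (u n) @[n --> \oo] --> nr l.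
Proof.
move=> /cvg_nrP h; apply/cvgrPdist_le => e /h; apply: filterS => n; apply: le_trans.
rewrite ler_norml; have := nrD (l - u n) (u n); have := nrD (u n - l) l.
rewrite !subrK (nr_distC l); lra.
Qed.

Lemma cvg_rip (u : nat -> H) (l y : H) :
  u @ \oo --> l -> rip (u n) y @[n --> \oo] --> rip l y.
Proof.
move=> /cvg_nrP h; apply/cvgrPdist_le => e e0.
have y1 : 0 < nr y + 1 by have := nr_ge0 y; lra.
have /h : 0 < e / (nr y + 1) by rewrite divr_gt0.
apply: filterS => n; rewrite ler_pdivlMr// => le.
rewrite -ripNl -ripDl; apply: le_trans (rip_le_nr _ _) _; apply: le_trans le.
by rewrite ler_wpM2l ?nr_ge0// lerDl.
Qed.

Lemma cauchy_nr (u : nat -> H) :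
    (forall e : R, 0 < e -> exists N, forall m n, (N <= m <= n)%N -> nr (u n - u m) <= e) ->
  cvgn u.
Proof.
move=> h; apply/cauchy_cvgP/cauchy_exP => e e0.
have er : e = (complex.Re e)%:C by rewrite RRe_real// gtr0_real.
have e2 : 0 < complex.Re e / 2 by rewrite divr_gt0// -ltcR -er.
have [N NP] := h _ e2.
exists (u N); exists N => // n /= Nn.
rewrite -ball_normE /= norm_nr er ltcR nr_distC.
apply: le_lt_trans (NP N n _) _; first by rewrite leqnn.
lra.
Qed.

End RealInnerProduct.

(** * Bounded linear maps and their pointwise limits *)

Section LinearMaps.
Context {R : realType} {H : completeNormedModType R[i]}.
Implicit Types (x y : H) (r : R) (T S : H -> H).

Lemma lin0 T : linear T -> T 0 = 0.
Proof. by move=> lT; have := lT (-1) 0 0; rewrite scaler0 addr0 scaleN1r addNr. Qed.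

Lemma linD T x y : linear T -> T (x + y) = T x + T y.
Proof. by move=> lT; have := lT 1 x y; rewrite !scale1r. Qed.

Lemma linZ T (z : R[i]) x : linear T -> T (z *: x) = z *: T x.
Proof. by move=> lT; have := lT z x 0; rewrite !addr0 lin0// addr0. Qed.

Lemma linN T x : linear T -> T (- x) = - T x.
Proof. by move=> lT; rewrite -scaleN1r linZ// scaleN1r. Qed.

Lemma linB T x y : linear T -> T (x - y) = T x - T y.
Proof. by move=> lT; rewrite linD// linN. Qed.

Lemma lin_sum T (I : Type) (s : seq I) (F : I -> H) : linear T ->
  T (\sum_(i <- s) F i) = \sum_(i <- s) T (F i).
Proof.
move=> lT; elim: s => [|i s IH]; first by rewrite !big_nil lin0.
by rewrite !big_cons linD// IH.
Qed.

Lemma lin_comp T S : linear T -> linear S -> linear (T \o S).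
Proof. by move=> lT lS a x y /=; rewrite lS lT. Qed.

Lemma lin_iter T n : linear T -> linear (iter n T).
Proof. by move=> lT; elim: n => [|n IH] a x y //=; rewrite IH lT. Qed.

Lemma bounded_opP T : bounded_op T <->
  linear T /\ exists2 M : R, 0 <= M & forall x, nr (T x) <= M * nr x.
Proof.
split=> [[lT [M TM]]|[lT [M M0 TM]]]; split=> //; last first.
  by exists M%:C => x; rewrite !norm_nr -rmorphM lecR.
exists `|complex.Re M| => [|x]; first exact: normr_ge0.
apply: (@le_trans _ _ (complex.Re M * nr x));
  last by rewrite ler_wpM2r ?nr_ge0// ler_norm.
have := TM x; rewrite !norm_nr lecE => /andP[_].
by case: M {TM} => a b /=; rewrite mulr0 subr0.
Qed.

Lemma bounded_op_linear T : bounded_op T -> linear T.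
Proof. by case. Qed.

Lemma bounded_op_id : bounded_op (@id H).
Proof. by split=> //; exists 1 => x; rewrite mul1r. Qed.

Lemma bounded_op_comp T S : bounded_op T -> bounded_op S -> bounded_op (T \o S).
Proof.
move=> /bounded_opP[lT [M M0 TM]] /bounded_opP[lS [K K0 SK]].
apply/bounded_opP; split; first exact: lin_comp.
exists (M * K); first by rewrite mulr_ge0.
by move=> x /=; apply: le_trans (TM _) _; rewrite -mulrA ler_wpM2l.
Qed.

Lemma bounded_op_iter T n : bounded_op T -> bounded_op (iter n T).
Proof.
move=> bT; elim: n => [|n IH]; first exact: bounded_op_id.
exact: (bounded_op_comp bT IH).
Qed.

Lemma bounded_opD T S : bounded_op T -> bounded_op S -> bounded_op (T \+ S).
Proof.
move=> /bounded_opP[lT [M M0 TM]] /bounded_opP[lS [K K0 SK]].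
apply/bounded_opP; split; first by move=> a x y /=; rewrite lT lS scalerDr addrACA.
exists (M + K); first by rewrite addr_ge0.
by move=> x /=; apply: le_trans (nrD _ _) _; rewrite mulrDl lerD.
Qed.

Lemma bounded_opZ (z : R[i]) T : bounded_op T -> bounded_op (fun x => z *: T x).
Proof.
move=> /bounded_opP[lT [M M0 TM]].
have z0 : 0 <= complex.Re `|z| by rewrite normc_def/= sqrtr_ge0.
apply/bounded_opP; split; first by move=> a x y; rewrite lT scalerDr !scalerA mulrC.
exists (complex.Re `|z| * M); first by rewrite mulr_ge0.
by move=> x; rewrite nrZ -mulrA ler_wpM2l.
Qed.

Lemma bounded_opB T S : bounded_op T -> bounded_op S -> bounded_op (T \- S).
Proof.
move=> bT /(bounded_opZ (-1)) bS; have := bounded_opD bT bS.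
by congr bounded_op; apply/funext => x /=; rewrite scaleN1r.
Qed.

Lemma op_norm_le T x : bounded_op T -> nr (T x) <= op_norm T * nr x.
Proof.
move=> /bounded_opP[lT [M M0 TM]].
have [/nr_eq0 ->|x0] := eqVneq (nr x) 0; first by rewrite lin0// nr0 mulr0.
have xp : 0 < nr x by rewrite lt_def x0 nr_ge0.
rewrite -ler_pdivrMr//; apply: ub_le_sup.
  exists M => _ [y /= y1 <-]; apply: le_trans (TM y) _.
  by rewrite ler_piMr// -lecR -norm_nr.
exists ((nr x)^-1%:C *: x) => /=.
  by rewrite norm_nr nrZr lecR gtr0_norm ?invr_gt0// mulVf.
by rewrite linZ// -/(nr _) nrZr gtr0_norm ?invr_gt0// mulrC.
Qed.

Lemma bounded_op_lim (U : nat -> H -> H) (M : R) : 0 <= M ->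
    (forall n, linear (U n)) -> (forall n x, nr (U n x) <= M * nr x) ->
    (forall x, cvgn (U ^~ x)) ->
  let L x := limn (U ^~ x) in
  [/\ linear L, forall x, nr (L x) <= M * nr x & bounded_op L].
Proof.
move=> M0 lU UM cvU L.
have lL : linear L.
  move=> a x y; apply/cvg_lim => //.
  have -> : U ^~ (a *: x + y) = (fun n => a *: U n x + U n y) by apply/funext => n;
    rewrite lU.
  by apply: cvgD; [apply: cvgZl_tmp; exact: cvU|exact: cvU].
have bL x : nr (L x) <= M * nr x.
  have cv : nr (U n x) @[n --> \oo] --> nr (L x) by apply: cvg_nr; exact: cvU.
  rewrite -(cvg_lim _ cv)//; apply: limr_le; first by apply/cvg_ex; eexists; exact: cv.
  by apply: nearW => n; exact: UM.
by split=> //; apply/bounded_opP; split=> //; exists M.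
Qed.

End LinearMaps.

(** * Hereditary forms *)

Section HereditaryForms.
Context {R : realType} {H : completeNormedModType R[i]}.
Variable ip : {dot H for @conjC R[i]}.
Hypothesis norm_ip : forall x : H, `|x| ^+ 2 = ip x x.
Implicit Types (x y : H) (T S : H -> H) (a b : nat -> R).

Local Notation sq := (sq ip).
Local Notation rip := (rip ip).

Definition orbit_sq T x (n : nat) : R := sq (iter n T x).

(** The trace of summability on forms: it is stable under [conv], passes to similar operators, and
    gives back strong convergence by [hered_psum_cvg]. *)
Definition form_bounded T a : Prop := exists2 M : R, 0 <= M &
  forall x N, \sum_(0 <= n < N) `|a n| * orbit_sq T x n <= M * sq x.

(* [<alpha(T^*, T) x, x>] *)
Definition hered_form T a x : R := limn (series (fun n => a n * orbit_sq T x n)).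

Lemma orbit_sq_ge0 T x n : 0 <= orbit_sq T x n.
Proof. exact: sq_ge0. Qed.

Lemma orbit_sq_iter T x n k : orbit_sq T (iter n T x) k = orbit_sq T x (n + k).
Proof. by rewrite /orbit_sq -iterD addnC. Qed.

Lemma hered_form_cvg T a x : form_bounded T a ->
  cvgn (series (fun n => a n * orbit_sq T x n)).
Proof.
move=> [M _ aM].
apply: (proj1 (@series_abs_bounded _ (fun n => a n * orbit_sq T x n) (M * sq x) _)) => N.
by under eq_bigr do rewrite normrM (ger0_norm (orbit_sq_ge0 _ _ _)); exact: aM.
Qed.

(** [conv_series] with the orbit of [x] as weight: the shifted weight is the orbit of [T^n x], so
    the bound on [b] at that vector is the required one. *)
Lemma hered_form_conv T a b : form_bounded T a -> form_bounded T b ->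
  form_bounded T (conv a b) /\ forall x,
    cvgn (series (fun n => a n * hered_form T b (iter n T x))) /\
    hered_form T (conv a b) x = limn (series (fun n => a n * hered_form T b (iter n T x))).
Proof.
move=> [A A0 hA] [M M0 hM].
have main x := @conv_series _ a b (orbit_sq T x) (A * sq x) M M0 (orbit_sq_ge0 T x) (hA x).
have hb x n N : \sum_(0 <= j < N) `|b j| * orbit_sq T x (n + j) <= M * orbit_sq T x n.
  by under eq_bigr do rewrite -orbit_sq_iter; exact: hM.
have fE x : (fun n => a n * hered_form T b (iter n T x)) =
    (fun n => a n * limn (series (fun j => b j * orbit_sq T x (n + j)))).
  apply/funext => n; rewrite /hered_form.
  by under [in LHS]eq_fun do rewrite orbit_sq_iter.
split=> [|x].
  exists (M * A) => [|x N]; first exact: mulr_ge0.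
  by have [+ _ _] := main x (hb x); rewrite -mulrA; apply.
have [_ cv cvab] := main x (hb x); rewrite fE; split=> //.
exact: cvg_lim cvab.
Qed.

Lemma form_bounded_cvg T a (P : H -> H) : bounded_op P ->
    (forall x, \sum_(0 <= n < N) `|a n| * orbit_sq T x n @[N --> \oo] --> rip (P x) x) ->
  form_bounded T a.
Proof.
move=> /bounded_opP[_ [M M0 PM]] cvP; exists M => // x N.
have incr : {homo (fun N => \sum_(0 <= n < N) `|a n| * orbit_sq T x n) :
    n m / (n <= m)%N >-> n <= m}.
  by apply: nondecreasing_series => n _ _; rewrite mulr_ge0// orbit_sq_ge0.
apply: le_trans (nondecreasing_cvgn_le incr (cvgP _ (cvP x)) N) _.
rewrite (cvg_lim _ (cvP x))//; apply: le_trans (ler_norm _) _.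
apply: le_trans (rip_le_nr norm_ip _ _) _; rewrite sq_nr// expr2 mulrA.
by rewrite ler_wpM2r// nr_ge0.
Qed.

Section Adjoint.
Variable T : H -> H.
Hypothesis bT : bounded_op T.
Let S := adjoint ip T.
Hypothesis bS : bounded_op S.
Hypothesis adjTS : forall x y, ip (T x) y = ip x (S y).

Let lT := bounded_op_linear bT.

Let psum a N := hered_psum ip T (fun n => (a n)%:C) N.

Lemma rip_iter_adjoint n x y : rip (iter n S x) y = rip x (iter n T y).
Proof.
elim: n x y => [//|n IH] x y.
by rewrite iterSr IH ripC// [in RHS]ripC// iterS /rip adjTS.
Qed.

Lemma rip_hered_psum a m n x y : (m <= n)%N ->
  rip (psum a n x - psum a m x) y =
  \sum_(m <= k < n) a k * rip (iter k T x) (iter k T y).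
Proof.
move=> mn; rewrite /psum /hered_psum (@big_cat_nat _ _ _ m 0 n)//=.
have -> (A B : H) : A + B - A = B by rewrite addrC addKr.
by rewrite rip_suml; apply: eq_bigr => k _; rewrite ripZl rip_iter_adjoint.
Qed.

Lemma hered_psum0 a x : psum a 0 x = 0.
Proof. by rewrite /psum /hered_psum big_geq. Qed.

Lemma rip_hered_psum_diag a N x :
  rip (psum a N x) x = \sum_(0 <= n < N) a n * orbit_sq T x n.
Proof. by have := rip_hered_psum a x x (leq0n N); rewrite hered_psum0 subr0. Qed.

Lemma hered_psum_bounded a N : bounded_op (psum a N).
Proof.
elim: N => [|N IH].
  have -> : psum a 0 = (fun x => 0 *: x) by apply/funext => x;
    rewrite hered_psum0 scale0r.
  exact: (bounded_opZ 0 (@bounded_op_id R H)).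
have -> : psum a N.+1 = psum a N \+ (fun x => (a N)%:C *: iter N S (iter N T x)).
  by apply/funext => x /=; rewrite /psum /hered_psum big_nat_recr.
apply: (bounded_opD IH); apply: bounded_opZ.
exact: (bounded_op_comp (bounded_op_iter N bS) (bounded_op_iter N bT)).
Qed.

(** Passage from forms to norms. The square of [v] is the sum of the [a k <T^k x, T^k v>];
    [rip_weighted_le] with weight [M] bounds its double by [M] times the sum at [x] plus [M^-1]
    times the sum at [v], and the latter is at most [|v|^2] by the bound on the form. *)
Lemma sq_hered_psum a (M : R) m n x : 0 < M -> (m <= n)%N ->
    (forall x N, \sum_(0 <= n < N) `|a n| * orbit_sq T x n <= M * sq x) ->
  sq (psum a n x - psum a m x) <= M * \sum_(m <= k < n) `|a k| * orbit_sq T x k.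
Proof.
move=> M0 mn aM; set v := psum a n x - _.
have a0 y k : 0 <= `|a k| * orbit_sq T y k by rewrite mulr_ge0// orbit_sq_ge0.
have tail : \sum_(m <= k < n) `|a k| * orbit_sq T v k <= M * sq v.
  apply: le_trans (aM v n); rewrite [leRHS](@big_cat_nat _ _ _ m 0 n)//= lerDr.
  by apply: sumr_ge0 => k _.
have : 2 * sq v <= M * \sum_(m <= k < n) `|a k| * orbit_sq T x k +
    M^-1 * \sum_(m <= k < n) `|a k| * orbit_sq T v k.
  rewrite {1}/sq rip_hered_psum// !mulr_sumr -big_split/=; apply: ler_sum => k _.
  rewrite !(mulrCA _ `|a k|) -mulrDr mulrCA.
  have [ak|ak] := leP 0 (a k).
    by rewrite ger0_norm// ler_wpM2l// rip_weighted_le.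
  rewrite ltr0_norm// -mulrNN ler_wpM2l ?oppr_ge0 ?(ltW ak)//.
  rewrite -mulrN -ripNl; have := rip_weighted_le norm_ip (- iter k T x) (iter k T v) M0.
  by rewrite sqN.
have : M^-1 * \sum_(m <= k < n) `|a k| * orbit_sq T v k <= sq v.
  by rewrite -ler_pdivlMl ?invr_gt0// invrK.
lra.
Qed.

Lemma hered_psum_cvg a : form_bounded T a -> 
  [/\ forall x, psum a N x @[N --> \oo] --> hered_calc ip T (fun n => (a n)%:C) x,
      bounded_op (hered_calc ip T (fun n => (a n)%:C)),
      forall x, ip (hered_calc ip T (fun n => (a n)%:C) x) x = (hered_form T a x)%:C &
      forall x y, rip (hered_calc ip T (fun n => (a n)%:C) x) y =
                  rip x (hered_calc ip T (fun n => (a n)%:C) y)].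
Proof.
move=> fa; have [M0 M00 aM0] := fa; pose M := M0 + 1.
have M_gt0 : 0 < M by rewrite ltr_wpDl.
have aM x N : \sum_(0 <= n < N) `|a n| * orbit_sq T x n <= M * sq x.
  by apply: le_trans (aM0 x N) _; rewrite ler_wpM2r ?sq_ge0// lerDl.
have a0 y k : 0 <= `|a k| * orbit_sq T y k by rewrite mulr_ge0// orbit_sq_ge0.
have cv x : cvgn (psum a ^~ x).
  apply: cauchy_nr => e e0.
  have [] := @series_abs_bounded _ (fun n => `|a n| * orbit_sq T x n) (M * sq x).
    by move=> N; under eq_bigr do rewrite ger0_norm//; exact: aM.
  move=> cva _; have e1 : 0 < e ^+ 2 / M by rewrite divr_gt0// exprn_gt0.
  have [N NP] := series_tail_le (a0 x) cva e1.
  exists N => m n /andP[Nm mn]; rewrite -(@ler_pXn2r _ 2) ?nnegrE ?nr_ge0 ?(ltW e0)//.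
  rewrite -(sq_nr norm_ip); apply: le_trans (sq_hered_psum x M_gt0 mn aM) _.
  by rewrite -ler_pdivlMl// mulrC; exact: NP.
have cvL x : psum a N x @[N --> \oo] --> hered_calc ip T (fun n => (a n)%:C) x by exact: cv.
have bnd N x : nr (psum a N x) <= M * nr x.
  have := sq_hered_psum x M_gt0 (leq0n N) aM; rewrite hered_psum0 subr0 => h.
  rewrite -(@ler_pXn2r _ 2) ?nnegrE ?nr_ge0 ?mulr_ge0 ?nr_ge0 ?(ltW M_gt0)//.
  rewrite exprMn -!(sq_nr norm_ip) expr2 -mulrA; apply: le_trans h _.
  by rewrite ler_pM2l.
have [_ _ bL] := bounded_op_lim (ltW M_gt0)
  (fun N => bounded_op_linear (hered_psum_bounded a N)) bnd cv.
have ripL x y : rip (psum a N x) y @[N --> \oo] --> rip (hered_calc ip T (fun n => (a n)%:C) x) y.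
  exact: cvg_rip.
have psumE N x y : rip (psum a N x) y = \sum_(0 <= k < N) a k * rip (iter k T x) (iter k T y).
  by have := rip_hered_psum a x y (leq0n N); rewrite hered_psum0 subr0.
split=> // [x|x y].
- have ReE : rip (hered_calc ip T (fun n => (a n)%:C) x) x = hered_form T a x.
    have := ripL x x; under eq_fun do rewrite rip_hered_psum_diag.
    by move=> /cvg_lim <-.
  (* Multiplication by ['i] turns imaginary parts into real ones; the real part of
     [<T^k x, T^k ('i x)>] is the imaginary part of [|T^k x|^2], which is 0. *)
  have ImE z x' : complex.Im (ip z x') = rip z ('i%C *: x').
    rewrite /rip linearZr_LR/=.
    by case: (ip z x') => p q /=; rewrite !(mul0r, mulr0, mul1r); ring.
  have Im0 : complex.Im (ip (hered_calc ip T (fun n => (a n)%:C) x) x) = 0.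
    rewrite ImE; have := ripL x ('i%C *: x); under eq_fun => N.
      rewrite psumE big1; first over.
      move=> k _; rewrite linZ; last exact: lin_iter.
      by rewrite -ImE (ip_sq norm_ip)/= mulr0.
    by move=> /cvg_lim <- //; rewrite lim_cst.
  by move: ReE Im0; rewrite /rip; case: (ip _ x) => p q /= -> ->.
- have := ripL x y; have := ripL y x; rewrite [in rip x _]ripC//.
  have -> : (fun N => rip (psum a N y) x) = (fun N => rip (psum a N x) y).
    by apply/funext => N; rewrite !psumE; apply: eq_bigr => k _; rewrite ripC.
  by move=> /cvg_lim <- // /cvg_lim <-.
Qed.

End Adjoint.
End HereditaryForms.

(** * From convergence of operator series to estimates of forms *)

Section Summability.
Context {R : realType} {H : completeNormedModType R[i]}.
Variable ip : {dot H for @conjC R[i]}.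
Hypothesis norm_ip : forall x : H, `|x| ^+ 2 = ip x x.
Variable T : H -> H.
Hypothesis bT : bounded_op T.
Hypothesis bS : bounded_op (adjoint ip T).
Hypothesis adjTS : forall x y, ip (T x) y = ip x (adjoint ip T y).
Implicit Types (a : nat -> R).

Local Notation sq := (sq ip).
Local Notation rip := (rip ip).

Lemma form_bounded_of_sot a :
  sot_summable ip T (fun n => `|a n|%:C) -> form_bounded ip T a.
Proof.
move=> [P [bP cvP]]; apply: (form_bounded_cvg norm_ip bP) => x.
have := @cvg_rip _ _ _ norm_ip _ _ x (cvP x).
by under eq_fun do rewrite (rip_hered_psum_diag adjTS).
Qed.

(** The use of operator norm convergence: [N] does not depend on [x], whereas strong convergence
    would give one for each [x]. *)
Lemma form_tail_of_norm a P e :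
    cvg_op_norm (hered_psum ip T (fun n => `|a n|%:C)) P -> 0 < e ->
  exists N, forall m n x, (N <= m)%N ->
    \sum_(m <= k < n) `|a k| * orbit_sq ip T x k <= e * sq x.
Proof.
move=> [bP cvP] e0; have e2 : 0 < e / 2 by rewrite divr_gt0.
have [N _ NP] := (@cvgrPdist_le _ _ _ _ _ _ _).1 cvP _ e2.
exists N => m n x Nm; have [nm|/ltnW mn] := leqP n m.
  by rewrite big_geq// mulr_ge0 ?sq_ge0// ltW.
have dist k : (N <= k)%N -> nr (hered_psum ip T (fun n => `|a n|%:C) k x - P x) <= e / 2 * nr x.
  move=> Nk; have bD : bounded_op (hered_psum ip T (fun n => `|a n|%:C) k \- P).
    by apply: bounded_opB => //; exact: hered_psum_bounded.
  apply: le_trans (op_norm_le x bD) _; rewrite ler_wpM2r ?nr_ge0//.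
  by apply: le_trans (ler_norm _) _; have := NP k Nk; rewrite sub0r normrN.
have <- := rip_hered_psum adjTS (fun n => `|a n|) x x mn.
apply: le_trans (ler_norm _) _; apply: le_trans (rip_le_nr norm_ip _ _) _.
rewrite sq_nr// expr2 mulrA ler_wpM2r ?nr_ge0//.
set u := hered_psum _ _ _ _ _; set v := hered_psum _ _ _ _ _.
have -> : u - v = (u - P x) - (v - P x) by rewrite opprB addrA subrK.
apply: le_trans (nrB _ _) _.
by have := dist n (leq_trans Nm mn); have := dist m Nm; rewrite -/u -/v; lra.
Qed.

Lemma form_bounded_of_norm a P :
    cvg_op_norm (hered_psum ip T (fun n => `|a n|%:C)) P -> form_bounded ip T a.
Proof.
move=> cvP; have [N NP] := form_tail_of_norm cvP ltr01.
have [C C0 CP] : exists2 C : R, 0 <= C &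
    forall x, \sum_(0 <= k < N) `|a k| * orbit_sq ip T x k <= C * sq x.
  elim: N {NP} => [|N [C C0 CP]]; first by exists 0 => // x; rewrite big_geq// mul0r.
  have /bounded_opP[_ [K K0 KP]] := bounded_op_iter N bT.
  exists (C + `|a N| * K ^+ 2); first by rewrite addr_ge0 ?mulr_ge0 ?exprn_ge0.
  move=> x; rewrite big_nat_recr//= mulrDl lerD// -mulrA ler_wpM2l//.
  by rewrite /orbit_sq !sq_nr// -exprMn ler_pXn2r ?nnegrE ?mulr_ge0 ?nr_ge0.
exists (C + 1); first by rewrite addr_ge0.
move=> x n; have a0 k : 0 <= `|a k| * orbit_sq ip T x k by rewrite mulr_ge0 ?orbit_sq_ge0.
apply: (@le_trans _ _ (\sum_(0 <= k < N + n) `|a k| * orbit_sq ip T x k)).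
  rewrite [leRHS](@big_cat_nat _ _ _ n 0 (N + n))//= ?leq_addl// lerDl.
  by apply: sumr_ge0.
rewrite (@big_cat_nat _ _ _ N 0 (N + n))//= ?leq_addr// mulrDl lerD//.
exact: NP.
Qed.

End Summability.

(** * Growth of the orbits *)

Section Parseval.
Context {R : realType} {H : completeNormedModType R[i]}.
Variable ip : {dot H for @conjC R[i]}.
Hypothesis norm_ip : forall x : H, `|x| ^+ 2 = ip x x.

Local Notation sq := (sq ip).

Lemma sum_even_odd (V : nmodType) (F : nat -> V) N :
  \sum_(0 <= n < N.*2) F n = \sum_(0 <= n < N) (F n.*2 + F n.*2.+1).
Proof.
elim: N => [|N IH]; first by rewrite !big_geq.
by rewrite doubleS !big_nat_recr//= IH addrA.
Qed.

(* A Parseval inequality on the circle of radius [s].  Averaging over [z] and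
   [-z] (parallelogram law) splits every polynomial of the family [l] into its
   even and odd parts, which are polynomials in [z ^+ 2]. *)
Lemma parseval_le k (s B : R) (l : seq (nat -> H)) : 0 <= s ->
    (forall z : R[i], `|z| = s%:C ->
       \sum_(v <- l) sq (\sum_(0 <= n < 2 ^ k) z ^+ n *: v n) <= B) ->
  \sum_(v <- l) \sum_(0 <= n < 2 ^ k) s ^+ (2 * n) * sq (v n) <= B.
Proof.
elim: k s l => [|k IH] s l s0 hB.
  have /hB : `|s%:C| = s%:C :> R[i] by rewrite ger0_norm// ler0c.
  rewrite expn0; under eq_bigr do rewrite big_nat1 expr0 scale1r.
  by under [in X in _ -> X]eq_bigr do rewrite big_nat1 expr0 mul1r.
pose ev (v : nat -> H) n := v n.*2.
(* The factor [s] accounts for the odd weights: [s ^+ (2 * (2n + 1))] is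
   [(s ^+ 2) ^+ (2 * n) * s ^+ 2]. *)
pose od (v : nat -> H) n := s%:C *: v n.*2.+1.
have := IH (s ^+ 2) (map ev l ++ map od l); rewrite sqr_ge0 => /(_ isT).
rewrite big_cat !big_map/= -big_split/=.
have -> : \sum_(v <- l) (\sum_(0 <= n < 2 ^ k) (s ^+ 2) ^+ (2 * n) * sq (ev v n) +
      \sum_(0 <= n < 2 ^ k) (s ^+ 2) ^+ (2 * n) * sq (od v n)) =
    \sum_(v <- l) \sum_(0 <= n < 2 ^ k.+1) s ^+ (2 * n) * sq (v n).
  apply: eq_bigr => v _; rewrite -big_split/= expnS mul2n sum_even_odd.
  apply: eq_bigr => n _; congr (_ + _); rewrite -exprM.
    by rewrite /ev -mul2n.
  rewrite /od sqZ// normc_def/= expr0n addr0 sqrtr_sqr ger0_norm// mulrA -exprD.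
  by congr (_ ^+ _ * _); lia.
(* A point of the circle of radius [s ^+ 2] has two square roots [z] and [- z] on the circle of
   radius [s]; the bounds at both add up to twice the one wanted at [z']. *)
apply=> z' z's; set z := sqrtC z'.
have zz : z ^+ 2 = z' by rewrite sqrtCK.
have zs : `|z| = s%:C.
  have s0C : 0 <= s%:C :> R[i] by rewrite ler0c.
  apply/eqP; rewrite -(eqrXn2 (isT : 0 < 2)%N (normr_ge0 z) s0C).
  by rewrite -normrX zz z's rmorphXn.
have nzs : `|- z| = s%:C by rewrite normrN.
have := hB z zs; have := hB (- z) nzs => h1 h2.
rewrite big_cat !big_map/= -big_split/= -(ler_pM2l (ltr0n _ 2)).
apply: (@le_trans _ _ (B + B)); last by lra.
apply: le_trans (lerD h2 h1); rewrite -big_split/= mulr_sumr le_eqVlt.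
apply/orP; left; apply/eqP; apply: eq_bigr => v _.
rewrite expnS mul2n !sum_even_odd.
pose e := \sum_(0 <= n < 2 ^ k) z' ^+ n *: ev v n.
pose o := \sum_(0 <= n < 2 ^ k) z' ^+ n *: v n.*2.+1.
have -> : \sum_(0 <= n < 2 ^ k) z' ^+ n *: od v n = s%:C *: o.
  by rewrite scaler_sumr; apply: eq_bigr => n _; rewrite scalerA mulrC -scalerA.
have pE (w : R[i]) : w ^+ 2 = z' ->
    \sum_(0 <= n < 2 ^ k) (w ^+ n.*2 *: v n.*2 + w ^+ n.*2.+1 *: v n.*2.+1) = e + w *: o.
  move=> wz; rewrite scaler_sumr -big_split/=; apply: eq_bigr => n _.
  by rewrite exprS scalerA /ev -mul2n exprM wz.
rewrite !pE ?sqrrN// scaleNr parallelogram// !sqZ// zs.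
by rewrite normc_def/= expr0n addr0 sqrtr_sqr ger0_norm.
Qed.

End Parseval.

(** * Lower bounds for [1 - z T] inside the unit disc *)

Section ResolventBounds.
Context {R : realType} {H : completeNormedModType R[i]}.
Variable T : H -> H.
Hypothesis bT : bounded_op T.
Hypothesis spec_T : spectrum T `<=` [set l : R[i] | `|l| <= 1].

(** For nonzero [z], [1 - z T = z (z^-1 - T)], and [z^-1] lies outside of the closed disc, hence
    outside of the spectrum. *)
Lemma resolvent_bound (z : R[i]) : `|z| < 1 ->
  exists2 M : R, 0 < M & forall y, nr y <= M * nr (y - z *: T y).
Proof.
move=> z1; have [->|z0] := eqVneq z 0.
  by exists 1 => // y; rewrite scale0r subr0 mul1r.
have : invertible_op (fun x => z^-1 *: x - T x).
  apply: contrapT => /spec_T/=; rewrite normfV invf_le1 ?normr_gt0//.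
  by move/(lt_le_trans z1); rewrite ltxx.
move=> [S /bounded_opP[lS [M M0 SM]] [TS _]].
have nz0 : 0 <= complex.Re `|z^-1| by rewrite normc_def/= sqrtr_ge0.
exists (M * complex.Re `|z^-1| + 1); first by rewrite ltr_wpDl ?mulr_ge0.
move=> y; have e : z^-1 *: y - T y = z^-1 *: (y - z *: T y).
  by rewrite scalerBr scalerA mulVf// scale1r.
rewrite -[leLHS](congr1 nr (TS y)); apply: le_trans (SM _) _.
by rewrite e nrZ mulrA ler_wpM2r ?nr_ge0// lerDl.
Qed.

Lemma Re_norm_complex_le (x y : R) : complex.Re `|x +i* y| <= `|x| + `|y|.
Proof.
rewrite normc_def/= -[leRHS]ger0_norm ?addr_ge0// -sqrtr_sqr ler_wsqrtr//.
rewrite -(real_normK (num_real x)) -(real_normK (num_real y)).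
have := normr_ge0 x; have := normr_ge0 y; nra.
Qed.

Lemma Re_norm_complexB (u v : R[i]) :
  complex.Re `|u| <= complex.Re `|v| + complex.Re `|v - u|.
Proof.
have := ler_normB v (v - u); rewrite opprB addrC subrK lecE => /andP[_].
by rewrite raddfD.
Qed.

(** A bound at [w] holds near [w] with twice the constant, and a square containing the disc is
    compact. Near a point of modulus at least 1 the condition [|z| <= r] fails, so nothing is
    claimed there. *)
Lemma uniform_resolvent_bound (r : R) : r < 1 ->
  exists2 M : R, 0 < M & forall (z : R[i]) y, complex.Re `|z| <= r ->
    nr y <= M * nr (y - z *: T y).
Proof.
move=> r1; have /bounded_opP[_ [K K0 TK]] := bT.
have [r0|r0] := ltP r 0.
  exists 1 => // z y; rewrite normc_def/= => h; exfalso.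
  by have := le_lt_trans (le_trans (sqrtr_ge0 _) h) r0; rewrite ltxx.
pose P (n : nat) (p : R * R) := forall y, complex.Re `|p.1 +i* p.2| <= r ->
  nr y <= n%:R * nr (y - (p.1 +i* p.2) *: T y).
have : compact (`[-1, 1 : R] `*` `[-1, 1 : R]) by apply: compact_setX;
  exact: segment_compact.
move=> /compact_near_coveringP/(_ nat \oo P _); case=> [p _|N _ NP]; last first.
  exists N.+1%:R => // -[a b] y zr.
  apply: (NP N.+1 (leqnSn N) (a, b)) => //=.
  have sqr1 : a ^+ 2 + b ^+ 2 <= 1.
    rewrite -[leRHS](expr1n _ 2) -[leLHS]sqr_sqrtr ?addr_ge0 ?sqr_ge0//.
    rewrite ler_pXn2r ?nnegrE ?sqrtr_ge0//; move: zr; rewrite normc_def/=; lra.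
  have := sqr_ge0 a; have := sqr_ge0 b => h1 h2.
  by split; rewrite in_itv/= -ler_norml -(@ler_pXn2r _ 2) ?nnegrE//
    real_normK ?num_real// expr1n; lra.
pose near_p (d : R) : set (R * R) := [set q | `|p.1 - q.1| <= d /\ `|p.2 - q.2| <= d].
have near_pP (d : R) : 0 < d -> nbhs p (near_p d).
  move=> d0; exists ([set x | `|p.1 - x| <= d], [set x | `|p.2 - x| <= d]) => //=.
    by split; apply/nbhs_ballP; exists d => // x; rewrite -ball_normE /= => /ltW.
pose w := p.1 +i* p.2.
have close d q : near_p d q -> complex.Re `|(q.1 +i* q.2) - w| <= 2 * d.
  move=> [h1 h2]; have -> : (q.1 +i* q.2) - w = (q.1 - p.1) +i* (q.2 - p.2) by [].
  apply: le_trans (Re_norm_complex_le _ _) _; rewrite distrC (distrC q.2); lra.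
have [w1|w1] := leP 1 (complex.Re `|w|).
  have d0 : 0 < (1 - r) / 4 by rewrite divr_gt0// subr_gt0.
  exists (near_p ((1 - r) / 4), setT) => [|[q n] [/= /close h _] y qr].
    by split; [exact: near_pP|exact: filterT].
  exfalso.
  by have := Re_norm_complexB w (q.1 +i* q.2); lra.
have [|M M0 MP] := @resolvent_bound w.
  by rewrite -[ltLHS]RRe_real ?normr_real// ltcR.
(* As [|z - w| <= 2 * d], the perturbation contributes at most
   [M * (2 * d) * (K + 1) * |y| = |y| / 2], which the left-hand side absorbs. *)
pose d := ((K + 1) * M * 4)^-1.
have K1 : 0 < K + 1 by rewrite ltr_wpDl.
have d0 : 0 < d by rewrite invr_gt0 !mulr_gt0.
have [N /ltW NM] : exists N : nat, 2 * M < N%:R by eexists; exact: truncnS_gt.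
exists (near_p d, [set n | (N <= n)%N]) => [|[q n] [/= /close h Nn] y _].
  by split; [exact: near_pP|exists N].
set z := q.1 +i* q.2 in h *.
have e : y - w *: T y = (y - z *: T y) + (z - w) *: T y.
  by rewrite scalerBl addrA subrK.
have := MP y; rewrite e => /le_trans/(_ (ler_wpM2l (ltW M0) (nrD _ _))).
rewrite nrZ mulrDr => h1.
have h2 : M * (complex.Re `|z - w| * nr (T y)) <= nr y / 2.
  have : complex.Re `|z - w| * nr (T y) <= 2 * d * ((K + 1) * nr y).
    apply: ler_pM => //; rewrite ?nr_ge0//.
      by rewrite normc_def/= sqrtr_ge0.
    by apply: le_trans (TK y) _; rewrite ler_wpM2r ?nr_ge0// lerDl.
  move=> /(ler_wpM2l (ltW M0)) /le_trans; apply.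
  rewrite /d le_eqVlt; apply/orP; left; apply/eqP; field.
  by rewrite !gt_eqF.
have Nn' : N%:R <= n%:R :> R by rewrite ler_nat.
have := nr_ge0 (y - z *: T y) => h3.
have : 2 * M * nr (y - z *: T y) <= n%:R * nr (y - z *: T y).
  by rewrite ler_wpM2r//; exact: le_trans NM Nn'.
lra.
Qed.

End ResolventBounds.

(** * Exponential estimates of the orbits from the spectrum *)

Section OrbitDecay.
Context {R : realType} {H : completeNormedModType R[i]}.
Variable ip : {dot H for @conjC R[i]}.
Hypothesis norm_ip : forall x : H, `|x| ^+ 2 = ip x x.
Variable T : H -> H.
Hypothesis bT : bounded_op T.

Local Notation sq := (sq ip).
Local Notation orbit_sq := (orbit_sq ip T).

Let lT : linear T := bounded_op_linear bT.

(** A strict ratio [q < 1], uniform in [x], makes coefficients of size [s ^+ (2 * n)] summable along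
    the orbits. *)
Definition orbit_decay (s : R) : Prop := exists2 C : R, 0 <= C &
  exists2 q : R, 0 <= q < 1 &
  forall n x, s ^+ (2 * n) * orbit_sq x n <= C * q ^+ n * sq x.

Lemma orbit_decay_le (s t : R) : 0 <= s <= t -> orbit_decay t -> orbit_decay s.
Proof.
move=> /andP[s0 st] [C C0 [q q01 h]]; exists C => //; exists q => // n x.
apply: le_trans (h n x); rewrite ler_wpM2r ?orbit_sq_ge0//.
by apply: lerXn2r; rewrite ?nnegrE// (le_trans s0).
Qed.

Lemma orbit_decay_small : exists2 s : R, 0 < s & orbit_decay s.
Proof.
have /bounded_opP[_ [K K0 TK]] := bT.
have K1 : 0 < K + 1 by rewrite ltr_wpDl.
pose s := (2 * (K + 1))^-1; have s0 : 0 < s by rewrite invr_gt0 mulr_gt0.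
have sK : s * K <= 1 / 2 by rewrite /s mulrC ler_pdivrMr ?mulr_gt0//; lra.
exists s => //; exists 1 => //; exists (1 / 4); first by lra.
move=> n x; rewrite mul1r.
have : s ^+ n * nr (iter n T x) <= (1 / 2) ^+ n * nr x.
  elim: n => [|n IH]; first by rewrite !expr0.
  rewrite iterS [s ^+ _]exprSr -mulrA.
  apply: (@le_trans _ _ (s ^+ n * (1 / 2 * nr (iter n T x)))).
    rewrite ler_wpM2l ?exprn_ge0 ?(ltW s0)//.
    apply: le_trans (ler_wpM2l (ltW s0) (TK _)) _.
    by rewrite mulrA ler_wpM2r ?nr_ge0.
  by rewrite mulrCA exprS -mulrA ler_wpM2l.
have h0 : 0 <= (1 / 2 : R) ^+ n by rewrite exprn_ge0.
rewrite -(@ler_pXn2r _ 2) ?nnegrE ?mulr_ge0 ?nr_ge0 ?exprn_ge0 ?(ltW s0)//.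
rewrite !exprMn -!(sq_nr norm_ip) -!exprM mulnC => /le_trans; apply.
by rewrite !expr1n !mul1r exprM exprVn (_ : 2 ^+ 2 = 4 :> R)//; ring.
Qed.

Lemma sum_iter_telescope (z : R[i]) x N :
  let p := \sum_(0 <= n < N) z ^+ n *: iter n T x in
  p - z *: T p = x - z ^+ N *: iter N T x.
Proof.
move=> p; rewrite /p lin_sum// scaler_sumr.
elim: N {p} => [|N IH]; first by rewrite !big_geq// subrr expr0 scale1r subrr.
rewrite !big_nat_recr//= opprD addrACA IH (linZ _ _ lT) scalerA -exprS.
by rewrite addrA subrK.
Qed.

(** The decay enters only to make [z^L T^L x] no longer than [x] for a large [L]. The telescoped sum
    then has norm at most [2 M |x|] on the circle, and Parseval's inequality gives a constant that
    depends on [M] alone. *)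
Lemma orbit_sum_le (s M : R) : 0 <= s -> 0 <= M -> orbit_decay s ->
    (forall (z : R[i]) y, complex.Re `|z| <= s -> nr y <= M * nr (y - z *: T y)) ->
  forall x N, \sum_(0 <= n < N) s ^+ (2 * n) * orbit_sq x n <= M ^+ 2 * 4 * sq x.
Proof.
move=> s0 M0 [C C0 [q /andP[q0 q1] dec]] res x N.
have [k0 Nk0] : exists k0, forall k, (k0 <= k)%N -> C * q ^+ k <= 1.
  have q1' : `|q| < 1 by rewrite ger0_norm.
  have [k0 _ k0P] := (@cvgrPdist_le _ _ _ _ _ _ _).1 (cvg_geometric C q1') _ ltr01.
  by exists k0 => k /k0P; rewrite sub0r normrN /geometric/=; exact/le_trans/ler_norm.
pose k := maxn N k0; pose L := (2 ^ k)%N.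
have kL : (k <= L)%N by rewrite ltnW// ltn_expl.
have NL : (N <= L)%N by exact: leq_trans (leq_maxl _ _) kL.
have k0L : (k0 <= L)%N by exact: leq_trans (leq_maxr _ _) kL.
apply: (@le_trans _ _ (\sum_(0 <= n < L) s ^+ (2 * n) * orbit_sq x n)).
  rewrite [leRHS](@big_cat_nat _ _ _ N 0 L)//= lerDl; apply: sumr_ge0 => n _.
  by rewrite mulr_ge0 ?orbit_sq_ge0 ?exprn_ge0.
have := @parseval_le _ _ _ norm_ip k s (M ^+ 2 * 4 * sq x) [:: fun n => iter n T x] s0.
rewrite big_seq1; apply => z zs; rewrite big_seq1.
set p := \sum_(0 <= n < _) _.
have zsR : complex.Re `|z| = s by rewrite zs.
have := res z p; rewrite zsR lexx => /(_ isT).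
rewrite sum_iter_telescope -/L => h.
have yL : sq (z ^+ L *: iter L T x) <= sq x.
  rewrite sqZ// normrX zs -rmorphXn/= -exprM mulnC.
  apply: le_trans (dec L x) _; rewrite ler_piMl ?sq_ge0//; exact: Nk0.
have nyL : nr (z ^+ L *: iter L T x) <= nr x.
  by rewrite -(@ler_pXn2r _ 2) ?nnegrE ?nr_ge0// -!(sq_nr norm_ip).
have : nr p <= M * (2 * nr x).
  apply: le_trans h _; rewrite ler_wpM2l//; apply: le_trans (nrB _ _) _; lra.
rewrite -(@ler_pXn2r _ 2) ?nnegrE ?mulr_ge0 ?nr_ge0// -(sq_nr norm_ip) => /le_trans;
  apply.
by rewrite !exprMn -(sq_nr norm_ip) mulrA (_ : 2 ^+ 2 = 4 :> R)//; ring.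
Qed.

(** The first term is at least [1 / K] of its tail, so removing it multiplies the tail by at most
    [1 - 1 / K]. *)
Lemma geometric_decay_of_tails (b : nat -> R) (K : R) : 1 <= K ->
    (forall n, 0 <= b n) ->
    (forall m N, \sum_(m <= n < N) b n <= K * b m) ->
  forall m, b m <= K * (1 - K^-1) ^+ m * b 0%N.
Proof.
move=> K1 b0 tail; have K0 : 0 < K by exact: lt_le_trans K1.
have k0 : 0 <= 1 - K^-1 by rewrite subr_ge0 invf_le1.
have main N m : (m <= N)%N -> \sum_(m <= n < N) b n <= (1 - K^-1) ^+ m * (K * b 0%N).
  elim: m => [|m IH] mN; first by rewrite expr0 mul1r.
  have := IH (ltnW mN); have := tail m N.
  have -> : \sum_(m <= n < N) b n = b m + \sum_(m.+1 <= n < N) b n by rewrite big_ltn.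
  set S := \sum_(m.+1 <= n < N) b n; rewrite exprS -mulrA => hS h.
  apply: le_trans (ler_wpM2l k0 h); move: hS; rewrite -ler_pdivrMl//; lra.
by move=> m; have := main m.+1 m (leqnSn m); rewrite big_nat1 mulrCA mulrA.
Qed.

(** The hypothesis at [T^m x] is a tail bound, hence decay with ratio [1 - i] for [i = 1 / K].
    Enlarging the radius is affordable because [(1 - i)(1 + i / 3)^2 <= 1 - i^2] on [[0, 1]]; the
    gain depends on [K] only. *)
Lemma orbit_decay_step (s K : R) : 0 <= s -> 1 <= K ->
    (forall x N, \sum_(0 <= n < N) s ^+ (2 * n) * orbit_sq x n <= K * sq x) ->
  orbit_decay (s * (1 + (3 * K)^-1)).
Proof.
move=> s0 K1 hK; have K0 : 0 < K by exact: lt_le_trans K1.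
exists K; first exact: ltW.
have i0 : 0 < K^-1 by rewrite invr_gt0.
have i1 : K^-1 <= 1 by rewrite invf_le1.
exists (1 - K^-1 ^+ 2); first by nra.
move=> n x.
have := @geometric_decay_of_tails (fun n => s ^+ (2 * n) * orbit_sq x n) K K1.
move=> /(_ _ _ n)/=; rewrite muln0 expr0 mul1r => h.
have {}h : s ^+ (2 * n) * orbit_sq x n <= K * (1 - K^-1) ^+ n * sq x.
  apply: h => [k|m N]; first by rewrite mulr_ge0 ?exprn_ge0 ?orbit_sq_ge0.
  have [Nm|/ltnW mN] := leqP N m.
    by rewrite big_geq// !mulr_ge0 ?exprn_ge0 ?orbit_sq_ge0// ltW.
  rewrite -{1}[m]add0n big_addn.
  have := ler_wpM2l (exprn_ge0 (2 * m) s0) (hK (iter m T x) (N - m)%N).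
  rewrite mulr_sumr mulrCA; apply: le_trans; rewrite le_eqVlt; apply/orP; left;
    apply/eqP.
  by apply: eq_bigr => j _; rewrite orbit_sq_iter mulrA -exprD -mulnDr (addnC m).
rewrite exprMn mulrAC.
have q0 : 0 <= 1 + (3 * K)^-1 by rewrite addr_ge0// invr_ge0 mulr_ge0// ltW.
apply: (@le_trans _ _ (K * (1 - K^-1) ^+ n * sq x * (1 + (3 * K)^-1) ^+ (2 * n))).
  by rewrite ler_wpM2r// exprn_ge0.
rewrite mulrAC ler_wpM2r ?sq_ge0// -mulrA ler_wpM2l ?(ltW K0)//.
rewrite exprM -exprMn; apply: lerXn2r; rewrite ?nnegrE.
- by rewrite mulr_ge0 ?subr_ge0// sqr_ge0.
- by rewrite subr_ge0 expr_le1// ltW.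
- rewrite invfM; set i := K^-1 in i0 i1 *.
  have -> : 1 - i ^+ 2 = (1 - i) * (1 + i) by ring.
  by rewrite ler_wpM2l ?subr_ge0//; nra.
Qed.

(** Continuation in the radius. The constant [K] comes from the resolvent bound on [|z| <= r], so
    every step gains the same factor [q > 1]; the minimum with [r] keeps the radius where this bound
    is available. *)
Lemma spectrum_orbit_decay : spectrum T `<=` [set l : R[i] | `|l| <= 1] ->
  forall s : R, 0 < s < 1 -> orbit_decay s.
Proof.
move=> spec_T r /andP[r0 r1].
have [M M0 res] := uniform_resolvent_bound bT spec_T r1.
pose K := M ^+ 2 * 4 + 1; have K1 : 1 <= K by rewrite lerDr mulr_ge0 ?sqr_ge0.
pose q := 1 + (3 * K)^-1.
have K0 : 0 < K by exact: lt_le_trans K1.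
have i0 : 0 < (3 * K)^-1 by rewrite invr_gt0 mulr_gt0.
have q1 : 1 < q by rewrite ltrDl.
have [s s0 ds] := orbit_decay_small.
have step j : orbit_decay (Num.min r (s * q ^+ j)).
  elim: j => [|j IH].
    apply: orbit_decay_le ds; rewrite expr0 mulr1 ge_min lexx orbT andbT.
    by rewrite le_min (ltW r0) ltW.
  set t := Num.min r _ in IH.
  have t0 : 0 <= t.
    by rewrite le_min (ltW r0)/= mulr_ge0 ?exprn_ge0 ?(ltW s0) ?(ltW (lt_trans ltr01 q1)).
  have tr : t <= r by rewrite ge_min lexx.
  have : orbit_decay (t * q).
    apply: orbit_decay_step => // x N.
    apply: le_trans (orbit_sum_le t0 (ltW M0) IH _ x N) _.
      by move=> z y zt; apply: res; exact: le_trans tr.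
    by rewrite ler_wpM2r ?sq_ge0// lerDl.
  apply: orbit_decay_le; apply/andP; split.
    by rewrite le_min (ltW r0)/= mulr_ge0 ?exprn_ge0 ?(ltW s0) ?(ltW (lt_trans ltr01 q1)).
  rewrite /t minr_pMl ?(ltW (lt_trans ltr01 q1))// le_min !ge_min exprSr mulrA lexx orbT andbT.
  by rewrite ler_peMr ?(ltW r0) ?(ltW q1).
have [j hj] : exists j, r <= s * q ^+ j.
  have [j /ltW hj] : exists j : nat, r / s / (3 * K)^-1 < j%:R by eexists;
    exact: truncnS_gt.
  exists j; rewrite -ler_pdivrMl// mulrC.
  have : 1 + (3 * K)^-1 *+ j <= q ^+ j.
    elim: j {hj} => [|j IH]; first by rewrite mulr0n addr0.
    rewrite exprS mulrS; have : 0 <= (3 * K)^-1 *+ j by rewrite mulrn_wge0 ?ltW.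
    move: IH; rewrite /q; set a := (3 * K)^-1 *+ j; nra.
  move: hj; rewrite ler_pdivrMr// -mulr_natl; lra.
by have := step j; rewrite (min_idPl hj).
Qed.

End OrbitDecay.

(** * Square roots of positive operators *)

Section SquareRoot.
Context {R : realType} {H : completeNormedModType R[i]}.
Implicit Types (x y : H).

Lemma cvg_geometric_steps (u : nat -> H) (K q : R) : 0 <= K -> 0 <= q < 1 ->
  (forall n, nr (u n.+1 - u n) <= K * q ^+ n) -> cvgn u.
Proof.
move=> K0 /andP[q0 q1] step; apply: cauchy_nr => e e0.
have q1' : `|q| < 1 by rewrite ger0_norm.
have g0 n : 0 <= geometric K q n by rewrite mulr_ge0// exprn_ge0.
have [N NP] := series_tail_le g0 (is_cvg_geometric_series (a := K) q1') e0.
exists N => m n /andP[Nm mn]; apply: le_trans (NP m n Nm).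
rewrite -(subnKC mn); elim: (n - m)%N => [|k IH].
  by rewrite addn0 subrr nr0 big_geq.
rewrite addnS big_nat_recr ?leq_addr//=.
have -> : u (m + k).+1 - u m = (u (m + k)%N - u m) + (u (m + k).+1 - u (m + k)%N).
  by rewrite [RHS]addrC addrA subrK.
by apply: le_trans (nrD _ _) _; exact: lerD.
Qed.

Lemma cvg_bounded_op (T : H -> H) (u : nat -> H) l :
  bounded_op T -> u @ \oo --> l -> T (u n) @[n --> \oo] --> T l.
Proof.
move=> /bounded_opP[lT [K K0 TK]] /cvg_nrP ul; apply/cvg_nrP => e e0.
have K1 : 0 < K + 1 by rewrite ltr_wpDl.
have /ul : 0 < e / (K + 1) by rewrite divr_gt0.
apply: filterS => n; rewrite ler_pdivlMr// => h.
rewrite -linB//; apply: le_trans (TK _) _; apply: le_trans h.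
by rewrite mulrC ler_wpM2l ?nr_ge0// lerDl.
Qed.

Lemma neumann (Y : H -> H) (q : R) : bounded_op Y -> 0 <= q < 1 ->
    (forall x, nr (Y x) <= q * nr x) ->
  exists Z, [/\ bounded_op Z, cancel (fun x => x - Y x) Z & cancel Z (fun x => x - Y x)].
Proof.
move=> bY /andP[q0 q1] Yq; have lY := bounded_op_linear bY.
pose Z n x := iter n (fun y => x + Y y) x.
have ZS n x : Z n.+1 x = x + Y (Z n x) by [].
have lZ n : linear (Z n).
  elim: n => [|n IH] a x y //; rewrite !ZS IH lY scalerDr.
  by rewrite addrACA.
have s0 : 0 < 1 - q by rewrite subr_gt0.
have bZ n x : nr (Z n x) <= (1 - q)^-1 * nr x.
  elim: n => [|n IH].
    by rewrite ler_peMl ?nr_ge0// invf_ge1//; lra.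
  rewrite ZS; apply: le_trans (nrD _ _) _.
  apply: (@le_trans _ _ (nr x + q * ((1 - q)^-1 * nr x))).
    by rewrite lerD2l; apply: le_trans (Yq _) _; rewrite ler_wpM2l.
  rewrite le_eqVlt; apply/orP; left; apply/eqP; field; lra.
have cvZ x : cvgn (Z ^~ x).
  apply: (@cvg_geometric_steps _ (q * nr x) q); rewrite ?q0 ?mulr_ge0 ?nr_ge0//.
  elim=> [|n IH].
    by rewrite ZS /= addrC addKr expr0 mulr1.
  rewrite (ZS n.+1) {2}ZS opprD addrACA subrr add0r -linB//.
  apply: le_trans (Yq _) _; rewrite exprS mulrCA; exact: ler_wpM2l.
have i0 : 0 <= (1 - q)^-1 by rewrite invr_ge0 ltW.
have [_ _ bL] := bounded_op_lim i0 lZ bZ cvZ.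
exists (fun x => limn (Z ^~ x)); set L := (fun x => _) in bL *.
have LE x : L x = x + Y (L x).
  have h1 : Z n.+1 x @[n --> \oo] --> L x by have := cvZ x;
    rewrite -(cvg_shiftS (fun n => Z n x)).
  have h2 : Z n.+1 x @[n --> \oo] --> x + Y (L x).
    by apply: cvgD; [exact: cvg_cst|apply: cvg_bounded_op; [exact: bY|exact: cvZ]].
  exact: cvg_unique h1 h2.
have LK : cancel L (fun x => x - Y x) by move=> x /=; rewrite {1}LE addrK.
split=> // x; apply/eqP; rewrite -subr_eq0; apply/eqP/nr_eq0.
(* [v] is a fixed point of the strict contraction [Y], hence zero. *)
set v := _ - x.
have vY : v = Y v.
  have vE : v = L (x - Y x) - x by [].
  have /= h := LK (x - Y x); rewrite vE (linB _ _ lY); move: (L _) h => w h.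
  have -> : Y w = w - (x - Y x) by rewrite -h opprB addrCA subrr addr0.
  by rewrite -addrA -opprD subrK.
apply/eqP; rewrite eq_le nr_ge0 andbT; have := Yq v; rewrite -vY => h.
have := nr_ge0 v; nra.
Qed.

End SquareRoot.

Section PositiveSquareRoot.
Context {R : realType} {H : completeNormedModType R[i]}.
Variable ip : {dot H for @conjC R[i]}.
Hypothesis norm_ip : forall x : H, `|x| ^+ 2 = ip x x.
Implicit Types (x y : H).

Local Notation sq := (sq ip).
Local Notation rip := (rip ip).

(** Positivity at [q x - X x] gives [2 q |X x|^2 <= q^2 <X x, x> + <X (X x), X x>]. The last term is
    at most [q |X x|^2], and [<X x, x>] is at most [q |x|^2]. *)
Lemma positive_op_norm_le (X : H -> H) (q : R) : linear X -> 0 < q ->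
    (forall x y, rip (X x) y = rip x (X y)) ->
    (forall x, 0 <= rip (X x) x <= q * sq x) ->
  forall x, nr (X x) <= q * nr x.
Proof.
move=> lX q0 symX posX x.
have /andP[+ _] := posX (q%:C *: x - X x).
rewrite (linB _ _ lX) (linZ _ _ lX) ripDl ripNl !ripDr !ripNr !ripZl !ripZr.
have /andP[_ h1] := posX x; have /andP[_ h2] := posX (X x).
rewrite (symX (X x) x) -/(sq (X x)) => h.
have : q * (q * rip (X x) x) <= q * (q * (q * sq x)) by rewrite !ler_wpM2l// ltW.
move=> h3; rewrite -(@ler_pXn2r _ 2) ?nnegrE ?mulr_ge0 ?nr_ge0 ?(ltW q0)//.
rewrite exprMn -!(sq_nr norm_ip) -(ler_pM2l q0); lra.
Qed.

Lemma cvg_op_square (Y : nat -> H -> H) (L : H -> H) (q : R) x : 0 <= q ->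
    (forall n, linear (Y n)) -> (forall n x, nr (Y n x) <= q * nr x) ->
    (forall x, Y n x @[n --> \oo] --> L x) ->
  Y n (Y n x) @[n --> \oo] --> L (L x).
Proof.
move=> q0 lY Yq cvY; apply/cvg_nrP => e e0.
have q1 : 0 < q + 1 by rewrite ltr_wpDl.
have e1 : 0 < e / 2 / (q + 1) by rewrite !divr_gt0.
have e2 : 0 < e / 2 by rewrite divr_gt0.
have := (cvg_nrP _ _).1 (cvY (L x)) _ e2.
have := (cvg_nrP _ _).1 (cvY x) _ e1.
apply: filterS2 => n; rewrite ler_pdivlMr// => h1 h2.
have -> : L (L x) - Y n (Y n x) = (L (L x) - Y n (L x)) + Y n (L x - Y n x).
  by rewrite (linB _ _ (lY n)) addrA subrK.
apply: le_trans (nrD _ _) _; have := Yq n (L x - Y n x).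
have := nr_ge0 (L x - Y n x); nra.
Qed.

(* [1 - X] is the square of [1 - Y], where [Y = (X + Y^2) / 2] is obtained by
   iteration; in operator norm the iteration is a contraction of the ball of
   radius [q], because [(q + q^2) / 2 <= q]. *)
Lemma contraction_square_root (X : H -> H) (q : R) : bounded_op X -> 0 <= q < 1 ->
    (forall x y, rip (X x) y = rip x (X y)) ->
    (forall x, nr (X x) <= q * nr x) ->
  exists Y, [/\ bounded_op Y, forall x, nr (Y x) <= q * nr x,
    forall x y, rip (Y x) y = rip x (Y y) &
    forall x, (x - Y x) - Y (x - Y x) = x - X x].
Proof.
move=> bX /andP[q0 q1] symX Xq; have lX := bounded_op_linear bX.
pose half : R := 1 / 2.
have half0 : 0 <= half by rewrite /half; lra.
pose Y := fix Y n := if n is n'.+1 then fun x => half%:C *: (X x + Y n' (Y n' x))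
  else fun _ : H => 0 : H.
have YS n x : Y n.+1 x = half%:C *: (X x + Y n (Y n x)) by [].
have lY n : linear (Y n).
  elim: n => [|n IH] a x y; first by rewrite /= scaler0 addr0.
  by rewrite !YS !IH lX !scalerDr !scalerA !(mulrC half%:C a) addrACA.
have Yq n x : nr (Y n x) <= q * nr x.
  elim: n x => [|n IH] x; first by rewrite /= nr0 mulr_ge0 ?nr_ge0.
  rewrite YS nrZr ger0_norm//; have := nrD (X x) (Y n (Y n x)).
  have := Xq x; have := IH (Y n x); have := ler_wpM2l q0 (IH x).
  have : q * (q * nr x) <= q * nr x.
    by rewrite ler_wpM2l// ler_piMl ?nr_ge0// ltW.
  rewrite /half; lra.
have symY n x y : rip (Y n x) y = rip x (Y n y).
  elim: n x y => [|n IH] x y; first by rewrite /= [RHS]ripC// !rip0l.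
  by rewrite !YS ripZl ripZr// ripDl ripDr symX !IH.
(* For consecutive iterates [A (A x) - B (B x) = A (A x - B x) + (A - B) (B x)]. Each term gains a
   factor [q], and [half] compensates for there being two of them. *)
have stepY n x : nr (Y n.+1 x - Y n x) <= nr x * q ^+ n.
  elim: n x => [|n IH] x.
    rewrite YS /= !subr0 addr0 nrZr ger0_norm// expr0 mulr1.
    have := Xq x; have : q * nr x <= nr x by rewrite ler_piMl ?nr_ge0// ltW.
    by have := nr_ge0 (X x); rewrite /half; lra.
  rewrite (YS n.+1) [X in _ - X](YS n) -scalerBr nrZr ger0_norm// opprD addrACA subrr add0r.
  set A := Y n.+1 in IH *; set B := Y n in IH *.
  have lA : linear A := lY n.+1.
  have -> : A (A x) - B (B x) = A (A x - B x) + (A (B x) - B (B x)).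
    by rewrite (linB _ _ lA) addrA subrK.
  have := nrD (A (A x - B x)) (A (B x) - B (B x)).
  have := Yq n.+1 (A x - B x); rewrite -/A.
  have := ler_wpM2l q0 (IH x); have := IH (B x).
  have := ler_wpM2r (exprn_ge0 n q0) (Yq n x); rewrite -/B exprS /half; lra.
have cvY x : cvgn (Y ^~ x).
  by apply: (@cvg_geometric_steps _ _ _ (nr x) q); rewrite ?nr_ge0 ?q0.
have [lL Lq bL] := bounded_op_lim q0 lY Yq cvY.
pose L x := limn (Y ^~ x).
have cvL x : Y n x @[n --> \oo] --> L x by exact: cvY.
exists L; split=> // [x y|x].
  have h := @cvg_rip _ _ _ norm_ip _ _ y (cvL x).
  have := @cvg_rip _ _ _ norm_ip _ _ x (cvL y).
  under eq_fun do rewrite ripC// -symY.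
  by rewrite [rip x _]ripC//; apply: cvg_unique.
have e : L x = half%:C *: (X x + L (L x)).
  have h1 : Y n.+1 x @[n --> \oo] --> L x.
    by have := cvL x; rewrite -(cvg_shiftS (fun n => Y n x)).
  have h2 : Y n.+1 x @[n --> \oo] --> half%:C *: (X x + L (L x)).
    apply: cvgZl_tmp; apply: cvgD; first exact: cvg_cst.
    exact: cvg_op_square q0 lY Yq cvL.
  exact: cvg_unique h1 h2.
rewrite -/(L _); have {}e : L x + L x = X x + L (L x).
  rewrite {1 2}e -scalerDl -rmorphD/= (_ : half + half = 1) ?scale1r// /half; lra.
have lL' : linear L := lL.
by rewrite -/(L (x - L x)) (linB _ _ lL') opprB addrACA -opprD e opprD addrACA subrr addr0.
Qed.

(** After division by a large scalar [m], [B] becomes [1 - X] with [0 <= X <= q < 1]; its root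
    [1 - Y] is inverted by a Neumann series. The scalar stays outside of the root. *)
Lemma positive_square_root (B : H -> H) (c M : R) : bounded_op B -> 0 < c ->
    (forall x y, rip (B x) y = rip x (B y)) ->
    (forall x, c * sq x <= rip (B x) x <= M * sq x) ->
  exists C C' m, [/\ [/\ bounded_op C, bounded_op C', cancel C C' & cancel C' C],
    forall x y, ip (C x) y = ip x (C y), 0 < m & forall x, rip (B x) x = m * sq (C x)].
Proof.
move=> bB c0 symB posB; have lB := bounded_op_linear bB.
(* Above [M], so that [X] is positive, and above [c], so that [q] is positive. *)
pose m := `|M| + c + 1.
have cm : c < m by rewrite /m; have := normr_ge0 M; lra.
have m0 : 0 < m by exact: lt_trans cm.
pose q := 1 - c / m.
have q01 : 0 <= q < 1.
  by rewrite subr_ge0 ler_pdivrMr// mul1r (ltW cm) ltrBlDr ltrDl divr_gt0.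
have q0 : 0 < q by rewrite subr_gt0 ltr_pdivrMr// mul1r.
pose X x := x - m^-1%:C *: B x.
have bX : bounded_op X.
  by apply: (bounded_opB (@bounded_op_id R H)); exact: bounded_opZ.
have symX x y : rip (X x) y = rip x (X y).
  by rewrite /X ripDl ripDr ripNl ripNr// ripZl ripZr// symB.
have posX x : 0 <= rip (X x) x <= q * sq x.
  have /andP[h1 h2] := posB x.
  rewrite /X ripDl ripNl ripZl -/(sq x) /q mulrBl mul1r lerD2l lerN2 subr_ge0.
  rewrite ler_pdivrMl// mulrAC ler_pdivrMr// mulrAC mulVf ?gt_eqF// mul1r h1 andbT.
  apply: le_trans h2 _; rewrite ler_wpM2r ?sq_ge0//.
  by have := ler_norm M; rewrite /m; lra.
have Xq := positive_op_norm_le (bounded_op_linear bX) q0 symX posX.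
have [Y [bY Yq symY YE]] := contraction_square_root bX q01 symX Xq.
have [Z [bZ CZ ZC]] := neumann bY q01 Yq.
pose C x := x - Y x.
have bC : bounded_op C by exact: (bounded_opB (@bounded_op_id R H)).
have symC x y : rip (C x) y = rip x (C y).
  by rewrite /C ripDl ripDr ripNl ripNr// symY.
exists C, Z, m; split=> // [x y|x].
  have ImE u v : complex.Im (ip u v) = rip u ('i%C *: v).
    rewrite /rip linearZr_LR/=.
    by case: (ip u v) => a b /=; rewrite !(mul0r, mulr0, mul1r); ring.
  have := symC x y; have := symC x ('i%C *: y).
  rewrite (linZ _ _ (bounded_op_linear bC)) -!ImE /rip.
  by case: (ip _ _) => a b; case: (ip _ _) => a' b' /= -> ->.
rewrite /sq symC -/(sq _); have -> : C (C x) = m^-1%:C *: B x.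
  by rewrite [LHS]YE /X opprB addrC subrK.
by rewrite ripZr// mulrA divff ?gt_eqF// mul1r symB.
Qed.

End PositiveSquareRoot.

(** * Similarity *)

Section PositiveForms.
Context {R : realType} {H : completeNormedModType R[i]}.
Variable ip : {dot H for @conjC R[i]}.
Hypothesis norm_ip : forall x : H, `|x| ^+ 2 = ip x x.
Implicit Types (T S : H -> H) (x y : H) (a b u p : nat -> R).

Local Notation sq := (sq ip).
Local Notation rip := (rip ip).
Local Notation form_bounded := (form_bounded ip).
Local Notation hered_form := (hered_form ip).
Local Notation orbit_sq := (orbit_sq ip).

Lemma hered_form_ge0 T a x : form_bounded T a -> (forall n, 0 <= a n) -> 0 <= hered_form T a x.
Proof.
move=> fa a0; apply: limr_ge; first exact: hered_form_cvg.
by apply: nearW => N; apply: sumr_ge0 => n _; rewrite mulr_ge0// orbit_sq_ge0.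
Qed.

Lemma hered_form_le T a : form_bounded T a ->
  exists2 M : R, 0 <= M & forall x, `|hered_form T a x| <= M * sq x.
Proof.
move=> [M M0 aM]; exists M => // x.
apply: (proj2 (@series_abs_bounded _ (fun n => a n * orbit_sq T x n) (M * sq x) _)) => N.
by under eq_bigr do rewrite normrM (ger0_norm (orbit_sq_ge0 norm_ip _ _ _)); exact: aM.
Qed.

Lemma hered_form_conv_ge0 T u a : form_bounded T u -> form_bounded T a ->
    (forall n, 0 <= u n) -> (forall x, 0 <= hered_form T a x) ->
  forall x, 0 <= hered_form T (conv u a) x.
Proof.
move=> fu fa u0 a0 x; have [_ /(_ x) [cv ->]] := hered_form_conv norm_ip fu fa.
by apply: limr_ge => //; apply: nearW => N; apply: sumr_ge0 => n _; rewrite mulr_ge0.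
Qed.

Lemma form_bounded_geometric T u (s K : R) : orbit_decay ip T s ->
  (forall n, 0 <= u n <= K * s ^+ (2 * n)) -> form_bounded T u.
Proof.
move=> [C C0 [q q01 dec]] uK; have /andP[u00 /(le_trans u00)] := uK 0%N.
rewrite muln0 expr0 mulr1 => K0.
have i0 : 0 <= (1 - q)^-1 by case/andP: q01 => _ q1; rewrite invr_ge0 subr_ge0 ltW.
exists (K * C * (1 - q)^-1) => [|x N]; first by rewrite !mulr_ge0.
apply: (@le_trans _ _ (\sum_(0 <= n < N) (K * C * sq x) * q ^+ n)).
  apply: ler_sum => n _; have /andP[un0 unK] := uK n; rewrite ger0_norm//.
  apply: le_trans (ler_wpM2r (orbit_sq_ge0 norm_ip T x n) unK) _.
  rewrite -[leLHS]mulrA; apply: le_trans (ler_wpM2l K0 (dec n x)) _.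
  by rewrite le_eqVlt; apply/orP; left; apply/eqP; ring.
rewrite -mulr_sumr [leRHS]mulrAC ler_wpM2l ?mulr_ge0 ?sq_ge0//.
exact: sum_geometric_le.
Qed.

(* The convolution with [u] makes [p], the main part of [b], nonnegative; the
   remaining part of [b] dominates [e] by itself. *)
Lemma hered_form_conv_lower_bound T u b p (e : R) : 0 <= e ->
    form_bounded T u -> form_bounded T b -> form_bounded T p ->
    (forall n, 0 <= u n) -> u 0%N = 1 -> (forall n, 0 <= conv u p n) ->
    (forall x, hered_form T p x + e * sq x <= hered_form T b x) ->
  forall x, e * sq x <= hered_form T (conv u b) x.
Proof.
move=> e0 fu fb fp u0 u1 up0 pb x.
have [fup /(_ x) [cvp pE]] := hered_form_conv norm_ip fu fp.
have [_ /(_ x) [cvb ->]] := hered_form_conv norm_ip fu fb.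
have := hered_form_ge0 x fup up0; rewrite pE => S0.
apply: (@le_trans _ _ (limn (series (fun n => u n * hered_form T p (iter n T x))) + e * sq x)).
  by rewrite lerDr.
have cst : e * sq x @[_ --> \oo] --> e * sq x by exact: cvg_cst.
rewrite -(cvg_lim _ cst)// -limD//; last exact: is_cvg_cst.
apply: ler_lim => //; first by apply: is_cvgD => //; exact: is_cvg_cst.
exists 1%N => // N /= N0; rewrite fctE /series/=.
(* The term [n = 0], with [u 0 = 1], supplies [e * sq x]; in the other terms this surplus is dropped
   as nonnegative. *)
rewrite -(prednK N0) !big_nat_recl//= u1 !mul1r addrAC lerD ?pb//.
apply: ler_sum => n _; rewrite ler_wpM2l//.
by apply: le_trans (pb _); rewrite lerDl mulr_ge0 ?sq_ge0.
Qed.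

(** Of the [2 * e] removed from the constant coefficient, one half pays for the tail of [b] and the
    other half remains as the margin. *)
Lemma hered_form_truncation T b p d (e : R) :
    form_bounded T b -> form_bounded T p -> (0 < d)%N ->
    (forall n, p n = if (n < d)%N then b n - (if n == 0%N then 2 * e else 0) else 0) ->
    (forall n x, \sum_(d <= k < n) `|b k| * orbit_sq T x k <= e * sq x) ->
  forall x, hered_form T p x + e * sq x <= hered_form T b x.
Proof.
move=> fb fp d0 pE tail x.
have cst : e * sq x @[_ --> \oo] --> e * sq x by exact: cvg_cst.
rewrite -(cvg_lim _ cst)// -limD; [|exact: hered_form_cvg|by apply: is_cvg_cst].
apply: ler_lim; [|exact: hered_form_cvg|].
  by apply: is_cvgD; [exact: hered_form_cvg|exact: is_cvg_cst].
exists d => // N /= dN; rewrite fctE /series/= !(@big_cat_nat _ _ _ d 0 N)//=.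
rewrite [X in _ + X + _]big_nat [X in _ + X + _]big1 ?addr0; last first.
  by move=> n /andP[dn _]; rewrite pE ltnNge dn mul0r.
have hd : \sum_(0 <= n < d) p n * orbit_sq T x n + 2 * e * sq x =
    \sum_(0 <= n < d) b n * orbit_sq T x n.
  rewrite -(prednK d0) !big_nat_recl//= !pE /= d0.
  rewrite mulrBl -[orbit_sq T x 0]/(sq x) addrAC subrK; congr (_ + _).
  rewrite !big_nat; apply: eq_bigr => n /andP[_ nd].
  by rewrite pE -(prednK d0) ltnS nd subr0.
have : `|\sum_(d <= n < N) b n * orbit_sq T x n| <= e * sq x.
  apply: le_trans (tail N x); apply: le_trans (ler_norm_sum _ _ _) _.
  by apply: ler_sum => n _; rewrite normrM (ger0_norm (orbit_sq_ge0 norm_ip _ _ _)).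
rewrite ler_norml => /andP[+ _]; rewrite -hd; lra.
Qed.

Lemma adjointP T : (exists S, bounded_op S /\ forall x y, ip (T x) y = ip x (S y)) ->
  bounded_op (adjoint ip T) /\ forall x y, ip (T x) y = ip x (adjoint ip T y).
Proof. exact: xgetPex. Qed.

(* If [T] has no adjoint, [adjoint] is the junk value [0] and only the constant
   coefficient counts; this case split replaces the Riesz theorem. *)
Lemma hered_psum_no_adjoint T (al : nat -> R[i]) N x :
    ~ (exists S, bounded_op S /\ forall x y, ip (T x) y = ip x (S y)) ->
  hered_psum ip T al N.+1 x = al 0%N *: x.
Proof.
move=> nadj; have adj0 : adjoint ip T = fun=> 0.
  by apply: xgetPN => S hS; apply: nadj; exists S.
rewrite /hered_psum adj0 big_nat_recl//= big1 ?addr0// => n _.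
by rewrite scaler0.
Qed.

End PositiveForms.

Section Similarity.
Context {R : realType} {H : completeNormedModType R[i]}.
Variable ip : {dot H for @conjC R[i]}.
Hypothesis norm_ip : forall x : H, `|x| ^+ 2 = ip x x.
Implicit Types (T S : H -> H) (x y : H) (a b u h : nat -> R).

Local Notation sq := (sq ip).
Local Notation rip := (rip ip).
Local Notation form_bounded := (form_bounded ip).
Local Notation hered_form := (hered_form ip).
Local Notation orbit_sq := (orbit_sq ip).

(* [h(T^*, T)] is bounded below, hence it defines an equivalent Hilbert norm, in
   which [alpha(T^*, T)] becomes [(alpha h)(T^*, T)]. *)
Lemma similar_of_dominating_form T a h (e : R) :
    bounded_op T -> bounded_op (adjoint ip T) ->
    (forall x y, ip (T x) y = ip x (adjoint ip T y)) ->
    form_bounded T a -> form_bounded T h -> 0 < e ->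
    (forall x, e * sq x <= hered_form T h x) ->
    (forall x, 0 <= hered_form T (conv a h) x) ->
  exists T', [/\ bounded_op T', similar_op T T',
    sot_summable ip T' (fun n => (a n)%:C) &
    nonneg_op ip (hered_calc ip T' (fun n => (a n)%:C))].
Proof.
move=> bT bS adj fa fh e0 hlow hpos.
have [_ bB ipB symB] := hered_psum_cvg norm_ip bT bS adj fh.
set B := hered_calc ip T _ in bB ipB symB.
have ripB x : rip (B x) x = hered_form T h x by rewrite /rip ipB.
have [Mh Mh0 hle] := hered_form_le norm_ip fh.
have Bbd x : e * sq x <= rip (B x) x <= Mh * sq x.
  by rewrite ripB hlow (le_trans (ler_norm _) (hle x)).
have [C [C' [m [[bC bC' CK C'K] symC m0 BC]]]] := positive_square_root norm_ip bB e0 symB Bbd.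
pose T' := C \o T \o C'.
have bT' : bounded_op T' by apply: bounded_op_comp => //; exact: bounded_op_comp.
have symC' x y : ip (C' x) y = ip x (C' y).
  by rewrite -{1}(C'K y) -symC C'K.
have [bS' adj'] : bounded_op (adjoint ip T') /\
    forall x y, ip (T' x) y = ip x (adjoint ip T' y).
  apply: adjointP; exists (C' \o adjoint ip T \o C); split.
    by apply: bounded_op_comp => //; exact: bounded_op_comp.
  by move=> x y /=; rewrite symC adj symC'.
have iterT' n x : iter n T' x = C (iter n T (C' x)).
  by elim: n => [|n IH] /=; rewrite ?C'K// IH /T' /= CK.
(* The norm along the orbit of [T'] at [x] is, up to the scalar [m], the form of [h] along the orbit
   of [T] at [C' x]. Weighted by [a], these values sum to the form of [conv a h] at [C' x]. *)
have orbE x n : orbit_sq T' x n = m^-1 * hered_form T h (iter n T (C' x)).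
  by rewrite /orbit_sq iterT' -ripB BC mulrA mulVf ?mul1r// gt_eqF.
have mi0 : 0 <= m^-1 by rewrite invr_ge0 ltW.
have fa' : form_bounded T' a.
  have [Ma Ma0 aM] := fa; have /bounded_opP[_ [K K0 C'le]] := bC'.
  exists (m^-1 * Mh * Ma * K ^+ 2); first by rewrite !mulr_ge0// sqr_ge0.
  move=> x N.
  apply: (@le_trans _ _ (m^-1 * Mh * \sum_(0 <= n < N) `|a n| * orbit_sq T (C' x) n)).
    rewrite mulr_sumr; apply: ler_sum => n _; rewrite orbE.
    have -> : m^-1 * Mh * (`|a n| * orbit_sq T (C' x) n) =
      `|a n| * (m^-1 * (Mh * orbit_sq T (C' x) n)) by ring.
    by rewrite !ler_wpM2l//; exact: le_trans (ler_norm _) (hle _).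
  have -> : m^-1 * Mh * Ma * K ^+ 2 * sq x = m^-1 * Mh * (Ma * (K ^+ 2 * sq x)) by ring.
  rewrite ler_wpM2l ?mulr_ge0//.
  apply: le_trans (aM _ _) _; rewrite ler_wpM2l//.
  by rewrite !sq_nr// -exprMn ler_pXn2r ?nnegrE ?mulr_ge0 ?nr_ge0.
have [cv' bL' ipL' _] := hered_psum_cvg norm_ip bT' bS' adj' fa'.
exists T'; split=> //.
- exists C', C; split=> //; apply/funext => x; rewrite /T' /= !CK//.
- by eexists; split; [exact: bL'|exact: cv'].
move=> x; rewrite ipL' ler0c.
have [_ /(_ (C' x)) [cvh hE]] := hered_form_conv norm_ip fa fh.
have -> : hered_form T' a x = m^-1 * hered_form T (conv a h) (C' x).
  rewrite hE /hered_form; apply/cvg_lim => //.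
  have -> : series (fun n => a n * orbit_sq T' x n) =
      (fun N => m^-1 * series (fun n => a n * hered_form T h (iter n T (C' x))) N).
    apply/funext => N; rewrite /series/= mulr_sumr; apply: eq_bigr => n _.
    by rewrite orbE mulrCA.
  by apply: cvgMl_tmp.
by rewrite mulr_ge0.
Qed.

Lemma similar_of_product T a b P :
    bounded_op T -> spectrum T `<=` [set l : R[i] | `|l| <= 1] ->
    bounded_op (adjoint ip T) -> (forall x y, ip (T x) y = ip x (adjoint ip T y)) ->
    form_bounded T a -> cvg_op_norm (hered_psum ip T (fun n => `|b n|%:C)) P ->
    (exists2 eta : R, 0 < eta & exists N, forall d (x : R), (N <= d)%N -> 0 <= x <= 1 ->
      eta <= \sum_(0 <= m < d) b m * x ^+ m) ->
    (forall x, 0 <= hered_form T (conv a b) x) ->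
  exists T', [/\ bounded_op T', similar_op T T',
    sot_summable ip T' (fun n => (a n)%:C) &
    nonneg_op ip (hered_calc ip T' (fun n => (a n)%:C))].
Proof.
move=> bT specT bS adj fa cvP [eta eta0 [N1 etaP]] cpos.
have fb := form_bounded_of_norm norm_ip bT bS adj cvP.
have e4 : 0 < eta / 4 by rewrite divr_gt0.
have [N2 tail] := form_tail_of_norm norm_ip bT bS adj cvP e4.
pose d := (maxn N1 N2).+1.
have N1d : (N1 <= d)%N by rewrite ltnW// ltnS leq_maxl.
have N2d : (N2 <= d)%N by rewrite ltnW// ltnS leq_maxr.
(* Half of [eta] is removed: a quarter for the tail beyond [d], a quarter as the final lower bound.
   The polynomial stays above [eta / 2] on [[0, 1]]. *)
pose p n := if (n < d)%N then b n - (if n == 0%N then 2 * (eta / 4) else 0) else 0.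
have p0 n : (d <= n)%N -> p n = 0 by rewrite /p ltnNge => ->.
have ppos (x : R) : 0 <= x <= 1 -> eta / 2 <= \sum_(0 <= m < d) p m * x ^+ m.
  move=> x01; have := etaP d x N1d x01.
  have -> : \sum_(0 <= m < d) p m * x ^+ m = \sum_(0 <= m < d) b m * x ^+ m - 2 * (eta / 4).
    rewrite !big_nat_recl//= !expr0 !mulr1 [p 0%N]/(b 0%N - _) [RHS]addrAC;
      congr (_ + _).
    rewrite !big_nat; apply: eq_bigr => n /andP[_ nd].
    by rewrite /p ltnS nd subr0.
  lra.
have fp : form_bounded T p.
  have [M M0 bM] := fb; exists (M + eta / 2);
    first by rewrite addr_ge0// divr_ge0// ltW.
  move=> x N.
  have px n : `|p n| * orbit_sq T x n <= `|b n| * orbit_sq T x n +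
      (if n == 0%N then eta / 2 else 0) * orbit_sq T x n.
    rewrite -mulrDl ler_wpM2r ?orbit_sq_ge0// /p.
    have -> : 2 * (eta / 4) = eta / 2 by field.
    have c0 : 0 <= (if n == 0%N then eta / 2 else 0) by case: ifP => // _;
      rewrite divr_ge0// ltW.
    case: ifP => _; last by rewrite normr0 addr_ge0.
    by apply: le_trans (ler_normB _ _) _; rewrite lerD2l ger0_norm.
  apply: le_trans (ler_sum _ _) _; first by move=> n _; exact: px.
  rewrite big_split/= mulrDl lerD//.
  case: N => [|N]; first by rewrite big_geq// mulr_ge0 ?sq_ge0// divr_ge0// ltW.
  by rewrite big_nat_recl//= big1 ?addr0// => n _; rewrite mul0r.
have eta2 : 0 < eta / 2 by rewrite divr_gt0.
have [s [u [K [s01 u1 uK up0]]]] := polya eta2 p0 ppos.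
have u0 n : 0 <= u n by have /andP[] := uK n.
have fu := form_bounded_geometric norm_ip (spectrum_orbit_decay norm_ip bT specT s01) uK.
have pb := hered_form_truncation norm_ip fb fp (ltn0Sn _) (fun=> erefl)
  (fun n x => tail d n x N2d).
have hlow := hered_form_conv_lower_bound norm_ip (ltW e4) fu fb fp u0 u1 up0 pb.
have [fh _] := hered_form_conv norm_ip fu fb.
have [fc _] := hered_form_conv norm_ip fa fb.
apply: (similar_of_dominating_form bT bS adj fa fh e4 hlow) => x.
(* The product [a (u b)] is [u (a b)]: nonnegative coefficients applied to a nonnegative form. *)
by rewrite convCA; exact: hered_form_conv_ge0.
Qed.

End Similarity.

Theorem theorem1p1 (R : realType) (H : completeNormedModType R[i])
    (ip : {dot H for @conjC R[i]})
    (norm_ip : forall x : H, `|x| ^+ 2 = ip x x)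
    (sepH : separable_space H)
    (That : H -> H) (That_bounded : bounded_op That)
    (spec_That : spectrum That `<=` [set l : R[i] | `|l| <= 1])
    (alpha gtilde gamma : nat -> R[i])
    (alpha_A : calA_R ip That alpha)
    (gtilde_A : calA0_R ip That gtilde)
    (gtilde_pos : forall t : R, 0 <= t <= 1 -> 0 < ps_sum gtilde t%:C)
    (gammaE : forall t : R[i], `|t| < 1 ->
      ps_has_sum gamma t (ps_sum alpha t * ps_sum gtilde t))
    (gamma_nonneg : nonneg_op ip (hered_calc ip That gamma)) :
  exists T : H -> H,
    [/\ bounded_op T, similar_op That T, sot_summable ip T alpha &
        nonneg_op ip (hered_calc ip T alpha)].
Proof.
have [[Walpha Salpha] Ralpha] := alpha_A.
have [[Wg [P cvP]] Rg] := gtilde_A.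
have real_seq (al : nat -> R[i]) : real_coefs al -> exists a, al = (fun n => (a n)%:C).
  by move=> hal; exists (fun n => complex.Re (al n)); apply/funext => n;
    rewrite RRe_real.
have abs_seq (a : nat -> R) : (fun n => `|(a n)%:C|) = (fun n => `|a n|%:C).
  by apply/funext => n; rewrite normc_def/= expr0n addr0 sqrtr_sqr.
have [[a alphaE] [b gE]] := (real_seq _ Ralpha, real_seq _ Rg).
subst alpha gtilde.
have cva := wiener_real Walpha; have cvb := wiener_real Wg.
have gammaC := product_coefs cva cvb gammaE; subst gamma.
have eta : exists2 eta : R, 0 < eta & exists N, forall d (x : R), (N <= d)%N -> 0 <= x <= 1 ->
    eta <= \sum_(0 <= m < d) b m * x ^+ m.
  apply: wiener_positive_truncation => // t t01.
  have [_ cvbt] := wiener_series_cvg cvb t01.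
  exists (limn (series (fun n => b n * t ^+ n))) => //.
  by rewrite -ltcR -ps_sum_real//; exact: gtilde_pos.
rewrite !abs_seq in Salpha cvP.
have [adj|nadj] := pselect (exists S, bounded_op S /\ forall x y, ip (That x) y = ip x (S y)).
  have [bS adjT] := adjointP adj.
  have fa := form_bounded_of_sot norm_ip adjT Salpha.
  have fb := form_bounded_of_norm norm_ip That_bounded bS adjT cvP.
  have [fc _] := hered_form_conv norm_ip fa fb.
  apply: (similar_of_product norm_ip That_bounded spec_That bS adjT fa cvP eta) => x.
  have [_ _ ipc _] := hered_psum_cvg norm_ip That_bounded bS adjT fc.
  by have := gamma_nonneg x; rewrite ipc ler0c.
(* In the case without adjoint the calculus is multiplication by the constant coefficient, which is
   [a 0 * b 0] for the product. The lower bound at [x = 0] gives [b 0 > 0], so [a 0] is nonnegative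
   and [That] itself can be taken. *)
have b0 : 0 < b 0%N.
  have [e e0 [N NP]] := eta; apply: (lt_le_trans e0).
  have := NP N.+1 0 (leqnSn N) _; rewrite lexx ler01 => /(_ isT).
  rewrite big_nat_recl// expr0 mulr1 big1 ?addr0// => n _.
  by rewrite expr0n mulr0.
have cst (al : nat -> R[i]) x : hered_psum ip That al N x @[N --> \oo] --> al 0%N *: x.
  rewrite -(cvg_shiftS (fun N => hered_psum ip That al N x)).
  by under eq_fun do rewrite hered_psum_no_adjoint//; exact: cvg_cst.
have calcE al : hered_calc ip That al = (fun x => al 0%N *: x).
  by apply/funext => x; exact: cvg_lim (cst al x).
have bid (z : R[i]) : bounded_op (fun x : H => z *: x).
  exact: (bounded_opZ z (@bounded_op_id R H)).
exists That; split=> //.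
- by exists id, id; split=> //; exact: bounded_op_id.
- by exists (fun x => (a 0%N)%:C *: x); split=> // x; exact: cst.
move=> x; rewrite calcE linearZl_LR/= (ip_sq norm_ip) -rmorphM ler0c.
have := gamma_nonneg x; rewrite calcE linearZl_LR/= (ip_sq norm_ip) -rmorphM ler0c.
by rewrite /conv big_nat1 subnn mulrAC pmulr_lge0.
Qed.
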